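(* Let $\mathcal{X},\mathcal{Y},\mathcal{Z},\mathcal{J},\widetilde{\mathcal{X}}$ be finite sets, let $P_X$ be a probability distribution on $\mathcal{X}$ with $P_X(x)>0$ for all $x$, let $W_{Y,Z|X,J}$ be a memoryless channel from $\mathcal{X}\times\mathcal{J}$ to $\mathcal{Y}\times\mathcal{Z}$, and let $d:\mathcal{X}\times\widetilde{\mathcal{X}}\to\mathbb{R}^+$ be a distortion measure with $d_{\max}=\max_{x,\tilde x}d(x,\tilde x)<\infty$. Let $R(D)$ be the adversarial rate distortion function of the associated arbitrarily varying remote source under randomized coding, and let $D_0$, $R_L^*(D)$, $R_U^*(D)$ be the quantities defined in the context. Then for every $D\ge D_0$, $$R_L^*(D)\;\le\; R(D)\;\le\; R_U^*(D).$$
   Context: **Operational problem.** A source emits $\mathbf{X}=(X_1,\dots,X_n)$ i.i.d. $\sim P_X$. An adversary observes all of $\mathbf{X}$ (non-causally) and chooses $\mathbf{J}\in\mathcal{J}^n$ according to an arbitrary conditional distribution $Q_{\mathbf{J}|\mathbf{X}}$. Given $\mathbf{X}=\mathbf{x},\mathbf{J}=\mathbf{j}$, the outputs satisfy $\mathbb{P}(\mathbf{Y}=\mathbf{y},\mathbf{Z}=\mathbf{z}\mid\mathbf{x},\mathbf{j})=\prod_{i=1}^n W_{Y,Z|X,J}(y_i,z_i|x_i,j_i)$. The encoder sees $\mathbf{Y}$; the decoder sees $\mathbf{Z}$ and the encoder's message (delivered without error). An $(n,R)$ deterministic code is a pair $(\psi,\phi)$ with $\psi:\mathcal{Y}^n\to\{1,\dots,2^{nR}\}$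 and $\phi:\{1,\dots,2^{nR}\}\times\mathcal{Z}^n\to\widetilde{\mathcal{X}}^n$. An $(n,R)$ randomized code is a random variable $(\Psi,\Phi)$ taking values in the set of $(n,R)$ deterministic codes; it is shared by encoder and decoder, unknown to the adversary, and independent of $(\mathbf{X},\mathbf{J},\mathbf{Y},\mathbf{Z})$. With $d(\mathbf{x},\tilde{\mathbf{x}})=\frac1n\sum_{i=1}^n d(x_i,\tilde x_i)$, the average distortion of the randomized code is $$D^{(n)}=\max_{Q_{\mathbf{J}|\mathbf{X}}}\mathbb{E}\big[d(\mathbf{X},\Phi(\Psi(\mathbf{Y}),\mathbf{Z}))\big],$$ the expectation being over the code, source, channel and the adversary's action. Given $D$, a rate $R$ is achievable if for every $\epsilon>0$ there is $n_0(\epsilon)$ such that for every $n\ge n_0(\epsilon)$ there is an $(n,R)$ randomized code with $D^{(n)}\le D+\epsilon$. $R(D)$ is the infimum of all achievable rates. **Single-letter quantities.** Let $\mathscr{Q}=\mathcal{P}(\mathcal{J}|\mathcal{X})$ be the set of all conditional distributions $Q_{J|X}$. For $Q_{J|X}\in\mathscr{Q}$, $(X,J,Y,Z)$ has joint distribution $P_XQ_{J|X}W_{Y,Z|X,J}$. Put $$D_0=\min_{\tilde x:\mathcal{Y}\times\mathcal{Z}\to\widetilde{\mathcal{X}}}\ \max_{Q_{J|X}\in\mathscr{Q}}\mathbb{E}[d(X,\tilde x(Y,Z))],\qquad D_1=\min_{\tilde x:\mathcal{Z}\to\widetilde{\mathcal{X}}}\ \max_{Q_{J|X}\in\mathscr{Q}}\mathbb{E}[d(X,\tilde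 x(Z))].$$ For an auxiliary random variable $U$ with finite alphabet $\mathcal{U}$ and conditional distribution $P_{U|Y}$, the joint distribution of $(X,J,Y,Z,U)$ is $P_XQ_{J|X}W_{Y,Z|X,J}P_{U|Y}$ (so $(X,J,Z)\leftrightarrow Y\leftrightarrow U$ is a Markov chain). - $R_U^*(D)=\min_{P_{U|Y},\,\tilde x(\cdot,\cdot)}\ \max_{Q_{J|X}\in\mathscr{Q}} I(U;Y|Z)$ if $D\in[D_0,D_1]$, and $R_U^*(D)=0$ if $D>D_1$. The minimum is over $P_{U|Y}\in\mathcal{P}(\mathcal{U}|\mathcal{Y})$ and $\tilde x:\mathcal{U}\times\mathcal{Z}\to\widetilde{\mathcal{X}}$ such that $\mathbb{E}[d(X,\tilde x(U,Z))]\le D$ for all $Q_{J|X}\in\mathscr{Q}$; one may restrict to $|\mathcal{U}|\le|\widetilde{\mathcal{X}}|^{|\mathcal{Z}|}$. - $R_L^*(D)=\max_{Q_{J|X}\in\mathscr{Q}}\ \min_{P_{U|Y},\,\tilde x(\cdot,\cdot)} I(U;Y|Z)$ if $D\in[D_0,D_1]$, and $R_L^*(D)=0$ if $D>D_1$. The inner minimum is over $P_{U|Y}\in\mathcal{P}(\mathcal{U}|\mathcal{Y})$ and $\tilde x:\mathcal{U}\times\mathcal{Z}\to\widetilde{\mathcal{X}}$ such that $\mathbb{E}[d(X,\tilde x(U,Z))]\le D$ for the given $Q_{J|X}$; one may restrict to $|\mathcal{U}|\le|\mathcal{Y}|+1$. *)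

(* Defs.v *)
(* Laws on finite alphabets are real-valued mass functions on finTypes;
   logarithms and rates are in bits.  Maxima and minima are written sup and inf:
   for D >= D0 and J, Xt nonempty, the sets involved are nonempty and bounded. *)
From HB Require Import structures.
From mathcomp Require Import all_boot all_order all_algebra.
From mathcomp Require Import all_classical all_reals all_analysis.

Set Implicit Arguments.
Unset Strict Implicit.
Unset Printing Implicit Defensive.

Import Order.TTheory GRing.Theory Num.Theory.
Local Open Scope classical_set_scope.
Local Open Scope ring_scope.

Definition is_dist (R : realType) (T : finType) (p : T -> R) : Prop :=
  (forall t, 0 <= p t) /\ \sum_t p t = 1.

Definition is_channel (R : realType) (A B : finType) (V : A -> B -> R) : Prop :=
  forall a, is_dist (V a).

Definition log2 (R : realType) (x : R) : R := ln x / ln 2.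

(* I(A;B|C) in bits for the joint mass function p of (A,B,C); terms with
   p a b c = 0 vanish, and otherwise all the marginals below are positive. *)
Definition cond_mutual_info (R : realType) (A B C : finType)
    (p : A -> B -> C -> R) : R :=
  \sum_a \sum_b \sum_c p a b c *
    log2 (p a b c * (\sum_a' \sum_b' p a' b' c) /
          ((\sum_b' p a b' c) * (\sum_a' p a' b c))).

Notation word n T := {ffun 'I_n -> T}.

Definition num_messages (R : realType) (n : nat) (r : R) : nat :=
  Num.truncn (2 `^ (n%:R * r)).

(* Encoder y |-> m and decoder (m, z) |-> xt, with messages 'I_M. *)
Definition code (n M : nat) (Y Z Xt : finType) : finType :=
  ({ffun word n Y -> 'I_M} * {ffun 'I_M * word n Z -> word n Xt})%type.

Definition decoded (n M : nat) (Y Z Xt : finType) (c : code n M Y Z Xt)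
    (y : word n Y) (z : word n Z) : word n Xt :=
  c.2 (c.1 y, z).

Definition word_distortion (R : realType) (X Xt : finType) (d : X -> Xt -> R)
    (n : nat) (x : word n X) (xt : word n Xt) : R :=
  n%:R^-1 * \sum_i d (x i) (xt i).

(* C is the law of the randomized code (Psi,Phi) on the finite set of
   deterministic codes; independence from (X,J,Y,Z) is the factor C c.
   Q is the adversary's non-causal strategy Q_{J|X} on words. *)
Definition code_distortion (R : realType) (X Y Z J Xt : finType)
    (PX : X -> R) (W : X * J -> Y * Z -> R) (d : X -> Xt -> R)
    (n M : nat) (C : code n M Y Z Xt -> R)
    (Q : word n X -> word n J -> R) : R :=
  \sum_(c : code n M Y Z Xt) \sum_(x : word n X) \sum_(j : word n J)
  \sum_(y : word n Y) \sum_(z : word n Z)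
    C c * (\prod_i PX (x i)) * Q x j * (\prod_i W (x i, j i) (y i, z i))
    * word_distortion d x (decoded c y z).

Definition max_code_distortion (R : realType) (X Y Z J Xt : finType)
    (PX : X -> R) (W : X * J -> Y * Z -> R) (d : X -> Xt -> R)
    (n M : nat) (C : code n M Y Z Xt -> R) : R :=
  sup [set code_distortion PX W d C Q | Q in
        [set Q : word n X -> word n J -> R | is_channel Q]].

Definition achievable (R : realType) (X Y Z J Xt : finType)
    (PX : X -> R) (W : X * J -> Y * Z -> R) (d : X -> Xt -> R) (D r : R) : Prop :=
  forall eps : R, 0 < eps -> exists n0 : nat, forall n : nat, (n0 <= n)%N ->
    exists C : code n (num_messages n r) Y Z Xt -> R,
      is_dist C /\ max_code_distortion PX W d C <= D + eps.

(* A negative rate leaves no messages, hence no code, at any positive length,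
   so the set below is bounded below by 0. *)
Definition rate_distortion (R : realType) (X Y Z J Xt : finType)
    (PX : X -> R) (W : X * J -> Y * Z -> R) (d : X -> Xt -> R) (D : R) : R :=
  inf [set r | achievable PX W d D r].

Definition joint (R : realType) (X Y Z J : finType)
    (PX : X -> R) (W : X * J -> Y * Z -> R) (Q : X -> J -> R)
    (x : X) (j : J) (y : Y) (z : Z) : R :=
  PX x * Q x j * W (x, j) (y, z).

Definition D0 (R : realType) (X Y Z J Xt : finType)
    (PX : X -> R) (W : X * J -> Y * Z -> R) (d : X -> Xt -> R) : R :=
  inf [set sup [set \sum_x \sum_j \sum_y \sum_z
                      joint PX W Q x j y z * d x (xt y z)
                   | Q in [set Q : X -> J -> R | is_channel Q]]
      | xt in [set: Y -> Z -> Xt]].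

Definition D1 (R : realType) (X Y Z J Xt : finType)
    (PX : X -> R) (W : X * J -> Y * Z -> R) (d : X -> Xt -> R) : R :=
  inf [set sup [set \sum_x \sum_j \sum_y \sum_z
                      joint PX W Q x j y z * d x (xt z)
                   | Q in [set Q : X -> J -> R | is_channel Q]]
      | xt in [set: Z -> Xt]].

(* (X,J,Z) <-> Y <-> U *)
Definition jointU (R : realType) (X Y Z J U : finType)
    (PX : X -> R) (W : X * J -> Y * Z -> R) (PU : Y -> U -> R)
    (Q : X -> J -> R) (x : X) (j : J) (y : Y) (z : Z) (u : U) : R :=
  joint PX W Q x j y z * PU y u.

Definition aux_distortion (R : realType) (X Y Z J Xt U : finType)
    (PX : X -> R) (W : X * J -> Y * Z -> R) (d : X -> Xt -> R)
    (PU : Y -> U -> R) (xt : U -> Z -> Xt) (Q : X -> J -> R) : R :=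
  \sum_x \sum_j \sum_y \sum_z \sum_u
    jointU PX W PU Q x j y z u * d x (xt u z).

Definition aux_info (R : realType) (X Y Z J U : finType)
    (PX : X -> R) (W : X * J -> Y * Z -> R)
    (PU : Y -> U -> R) (Q : X -> J -> R) : R :=
  cond_mutual_info (fun (u : U) (y : Y) (z : Z) =>
    \sum_x \sum_j jointU PX W PU Q x j y z u).

(* In RU and RL the auxiliary alphabet U ranges over all finite sets, with no
   cardinality bound. *)
Definition RU (R : realType) (X Y Z J Xt : finType)
    (PX : X -> R) (W : X * J -> Y * Z -> R) (d : X -> Xt -> R) (D : R) : R :=
  if D1 PX W d < D then 0 else
  inf [set v | exists (U : finType) (PU : Y -> U -> R) (xt : U -> Z -> Xt),
    [/\ is_channel PU,
        forall Q : X -> J -> R, is_channel Q ->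
          aux_distortion PX W d PU xt Q <= D
      & v = sup [set aux_info PX W PU Q
                | Q in [set Q : X -> J -> R | is_channel Q]]]].

Definition RL (R : realType) (X Y Z J Xt : finType)
    (PX : X -> R) (W : X * J -> Y * Z -> R) (d : X -> Xt -> R) (D : R) : R :=
  if D1 PX W d < D then 0 else
  sup [set inf [set v |
              exists (U : finType) (PU : Y -> U -> R) (xt : U -> Z -> Xt),
                [/\ is_channel PU,
                    aux_distortion PX W d PU xt Q <= D
                  & v = aux_info PX W PU Q]]
      | Q in [set Q : X -> J -> R | is_channel Q]].

(* Main.v *)
(* Converse. Against the adversary drawing J_i from Q(.|X_i) the remote source
   is an i.i.d. one, and a deterministic code of the mixture is at least as good
   as the randomized code. The chain rule, peeling off one letter at a time,
   gives auxiliary variables U_i, which time sharing merges into one U with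
   I(U;Y|Z) <= r and distortion at most D + eps. Replacing U by the function
   xt(U,.) fixes a finite alphabet, and compactness lets eps go to 0.

   Achievability. For a fixed test channel PU the information I_Q(U;Y|Z) is
   concave in Q and is the minimum over q of the linear functional
   E_Q[ln (PU(U|Y) / q(U|Z))]. Hence a single q(u|z), the posterior of a nearly
   worst Q, satisfies E_Q[ln (PU / q)] <= v + eps for every Q. The decoder
   needs to know nothing else about the adversary. Encoder and decoder share
   independent random times T(u,m), for u a word and m a message; the encoder
   takes the minimizer of T(u,m) / PU(u|y) and sends m, and the decoder the
   minimizer of T(u,m) / q(u|z) (the Poisson matching lemma of Li and
   Anantharam). The encoder's u has law PU(.|y) exactly, so the distortion is the
   single-letter one unless the decoder differs, which has probability at most
   E[(PU / (M q))^lam]. That is a product over the letters, so that the best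
   choice of the adversary is letter by letter and a Chernoff bound applies. *)
Require Import Defs.
From HB Require Import structures.
From mathcomp Require Import all_boot all_order all_algebra.
From mathcomp Require Import all_classical all_reals all_analysis.
From mathcomp Require Import ring lra.

Set Implicit Arguments.
Unset Strict Implicit.
Unset Printing Implicit Defensive.

Import Order.TTheory GRing.Theory Num.Theory.
Import numFieldNormedType.Exports.
Local Open Scope classical_set_scope.
Local Open Scope ring_scope.

(** * Conditional information and log-loss *)

(** In the application [A], [B], [V] are the alphabets of Y, Z, U: [s] is the joint law of (Y, Z),
    and [K] the test channel, so that V depends on B only through A. *)
Definition mass (R : realType) (A B : finType) (s : A -> B -> R) (b : B) : R :=
  \sum_a s a b.

Definition out_mass (R : realType) (A B V : finType) (s : A -> B -> R)
    (K : A -> V -> R) (b : B) (v : V) : R :=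
  \sum_a s a b * K a v.

(** The conditional law of V given B. Where B has mass 0 it is 0/0 = 0, so in general its total is
    only at most 1. *)
Definition posterior (R : realType) (A B V : finType) (s : A -> B -> R)
    (K : A -> V -> R) (b : B) (v : V) : R :=
  out_mass s K b v / mass s b.

Definition log_loss (R : realType) (A B V : finType) (s : A -> B -> R)
    (K : A -> V -> R) (q : B -> V -> R) : R :=
  \sum_a \sum_b \sum_v s a b * K a v * ln (K a v / q b v).

(** This is I(V;A|B) in nats: by the Markov property [K a] is already the law of V given (A, B).
    Log-loss with [q] free is kept separate because it is linear in [s]. *)
Definition info (R : realType) (A B V : finType) (s : A -> B -> R)
    (K : A -> V -> R) : R :=
  log_loss s K (posterior s K).

Lemma ln_ge1BV (R : realType) (x : R) : 0 < x -> 1 - x^-1 <= ln x.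
Proof.
move=> x0; rewrite -[x in ln x]invrK lnV ?posrE ?invr_gt0//.
have := @le_ln1Dx R (x^-1 - 1); rewrite ltrBrDl subrr invr_gt0 => /(_ x0).
by rewrite addrC subrK => ?; lra.
Qed.

Lemma ln_div_ge (R : realType) (x y : R) :
  0 < x -> 0 < y -> 1 - y / x <= ln (x / y).
Proof.
by move=> x0 y0; rewrite -invf_div; apply: ln_ge1BV; rewrite divr_gt0.
Qed.

Section InfoBounds.
Context (R : realType) (A B V : finType) (s : A -> B -> R) (K : A -> V -> R).
Hypothesis s_ge0 : forall a b, 0 <= s a b.
Hypothesis K_channel : is_channel K.

Let K_ge0 a v : 0 <= K a v. Proof. by case: (K_channel a). Qed.
Let sK_ge0 a b v : 0 <= s a b * K a v. Proof. exact: mulr_ge0. Qed.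

Lemma mass_ge0 b : 0 <= mass s b. Proof. exact: sumr_ge0. Qed.

Lemma out_mass_ge0 b v : 0 <= out_mass s K b v.
Proof. by apply: sumr_ge0 => a _. Qed.

Lemma le_mass a b : s a b <= mass s b.
Proof. by rewrite /mass (bigD1 a)//= lerDl sumr_ge0. Qed.

Lemma le_out_mass a b v : s a b * K a v <= out_mass s K b v.
Proof. by rewrite /out_mass (bigD1 a)//= lerDl sumr_ge0. Qed.

Lemma sum_out_mass b : \sum_v out_mass s K b v = mass s b.
Proof.
rewrite exchange_big/=; apply: eq_bigr => a _.
by rewrite -mulr_sumr; case: (K_channel a) => _ ->; rewrite mulr1.
Qed.

Lemma posterior_ge0 b v : 0 <= posterior s K b v.
Proof. by rewrite divr_ge0 ?mass_ge0 ?out_mass_ge0. Qed.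

Lemma sum_posterior_le1 b : \sum_v posterior s K b v <= 1.
Proof.
have [m0|m0] := eqVneq (mass s b) 0.
  by rewrite big1// => v _; rewrite /posterior m0 invr0 mulr0.
by rewrite -mulr_suml sum_out_mass mulrV ?unitfE.
Qed.

Lemma mass_posterior b v : mass s b * posterior s K b v = out_mass s K b v.
Proof.
have [m0|m0] := eqVneq (mass s b) 0; last by rewrite mulrC divfK.
rewrite m0 mul0r; apply/esym/eqP; rewrite eq_le out_mass_ge0 andbT.
rewrite -m0 -sum_out_mass (bigD1 v)//= lerDl sumr_ge0// => *.
exact: out_mass_ge0.
Qed.

Lemma posterior_gt0 a b v : 0 < s a b * K a v -> 0 < posterior s K b v.
Proof.
move=> h; rewrite divr_gt0//; first exact: lt_le_trans (le_out_mass a b v).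
apply: lt_le_trans (le_mass a b); rewrite lt_neqAle s_ge0 andbT eq_sym.
by apply: contraTneq h => ->; rewrite mul0r ltxx.
Qed.

Lemma mul_gt0_factors a b v : 0 < s a b * K a v -> 0 < s a b /\ 0 < K a v.
Proof.
move=> h; split; rewrite lt_neqAle ?s_ge0 ?K_ge0 andbT eq_sym;
  by apply: contraTneq h => ->; rewrite ?mul0r ?mulr0 ltxx.
Qed.

(* Gibbs: bounding [ln (post / q)] below by [1 - q / post] leaves the sum over
   [b] of [mass - mass * sum_v q], which is nonnegative. *)
Lemma info_le_log_loss (q : B -> V -> R) :
  (forall b v, 0 <= q b v) -> (forall b, \sum_v q b v <= 1) ->
  (forall a b v, 0 < s a b * K a v -> 0 < q b v) ->
  info s K <= log_loss s K q.
Proof.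
move=> q_ge0 q_le1 q_gt0; rewrite -subr_ge0.
apply: (@le_trans _ _ (\sum_b (mass s b - mass s b * \sum_v q b v))).
  by apply: sumr_ge0 => b _; rewrite subr_ge0 ler_piMr ?mass_ge0.
under eq_bigr do rewrite -sum_out_mass mulr_sumr -sumrB.
rewrite /info /log_loss -sumrB.
under [leRHS]eq_bigr do rewrite -sumrB; under [leRHS]eq_bigr do
  under eq_bigr do rewrite -sumrB.
rewrite [leRHS]exchange_big/=; apply: ler_sum => b _.
rewrite [leRHS]exchange_big/=; apply: ler_sum => v _.
have [p0|] := ltP 0 (posterior s K b v); last first.
  rewrite le_eqVlt ltNge posterior_ge0 orbF => /eqP p0.
  rewrite -mass_posterior sum_out_mass p0 mulr0 sub0r.
  rewrite big1 => [|a _]; first by rewrite oppr_le0 mulr_ge0 ?mass_ge0.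
  have /eqP -> : s a b * K a v == 0; last by rewrite !mul0r subrr.
  rewrite eq_le sK_ge0 andbT (le_trans (le_out_mass a b v))//.
  by rewrite -mass_posterior p0 mulr0.
apply: (@le_trans _ _ (\sum_a s a b * K a v * (1 - q b v / posterior s K b v))).
  rewrite -mulr_suml -/(out_mass s K b v) mulrBr mulr1 lerD2l lerN2.
  rewrite sum_out_mass -(mass_posterior b v) -mulrA ler_wpM2l ?mass_ge0//.
  by rewrite mulrCA mulfV ?gt_eqF// mulr1.
apply: ler_sum => a _; rewrite -mulrBr.
have [sK0|] := ltP 0 (s a b * K a v); last first.
  by rewrite le_eqVlt ltNge sK_ge0 orbF => /eqP ->; rewrite !mul0r.
rewrite ler_pM2l//; have q0 := q_gt0 _ _ _ sK0.
have [_ K0] := mul_gt0_factors sK0.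
rewrite (ln_div (y:=q b v)) ?posrE// (ln_div (y:=posterior s K b v)) ?posrE//.
by have := ln_div_ge p0 q0; rewrite ln_div ?posrE//; lra.
Qed.

(** For each pair (a, b), [ln x >= 1 - 1/x] bounds the sum over [v] below by [s] times the
    difference of the totals of [K a] and of the posterior, that is of 1 and something at most 1. *)
Lemma info_ge0 : 0 <= info s K.
Proof.
rewrite /info /log_loss; apply: sumr_ge0 => a _; apply: sumr_ge0 => b _.
apply: (@le_trans _ _ (\sum_v s a b * (K a v - posterior s K b v))).
  rewrite -mulr_sumr sumrB; case: (K_channel a) => _ ->.
  by rewrite mulr_ge0// subr_ge0 sum_posterior_le1.
apply: ler_sum => v _.
have [sK0|] := ltP 0 (s a b * K a v); last first.
  rewrite le_eqVlt ltNge sK_ge0 orbF mulrBr => /eqP ->.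
  by rewrite mul0r sub0r oppr_le0 mulr_ge0 ?posterior_ge0.
have [s0 K0] := mul_gt0_factors sK0; have p0 := posterior_gt0 sK0.
rewrite -mulrA ler_pM2l//.
apply: (@le_trans _ _ (K a v * (1 - posterior s K b v / K a v))).
  by rewrite mulrBr mulr1 mulrCA mulfV ?gt_eqF// mulr1.
by rewrite ler_pM2l// ln_div_ge.
Qed.

(** The uniform law is one choice of [q] in [info_le_log_loss], and its log-loss is at most ln of
    the cardinality because [K <= 1]. *)
Lemma info_le_ln_card : \sum_a \sum_b s a b = 1 -> info s K <= ln #|V|%:R.
Proof.
move=> s1.
(* A channel into an empty [V] forces [A] to be empty, against the total mass 1. *)
have [V0|V0] := posnP #|V|.
  have K0 a : \sum_v K a v = 0 by rewrite big1// => v; have := card0_eq V0 v.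
  have : (1 : R) = 0 => [|/eqP]; last by rewrite oner_eq0.
  rewrite -s1 big1// => a _; have := K0 a.
  by case: (K_channel a) => _ -> /eqP; rewrite oner_eq0.
have V0' : 0 < #|V|%:R :> R by rewrite ltr0n.
apply: (@le_trans _ _ (log_loss s K (fun _ _ => #|V|%:R^-1))).
  apply: info_le_log_loss => [b v|b|a b v _]; rewrite ?invr_ge0 ?invr_gt0//.
  by rewrite sumr_const -[leLHS]mulr_natl cardT -cardT mulfV ?gt_eqF.
rewrite -[leRHS]mul1r -[X in _ <= X * _]s1 mulr_suml; apply: ler_sum => a _.
rewrite mulr_suml; apply: ler_sum => b _.
have {2}-> : s a b = \sum_v s a b * K a v.
  by rewrite -mulr_sumr; case: (K_channel a) => _ ->; rewrite mulr1.
rewrite mulr_suml; apply: ler_sum => v _.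
have [sK0|] := ltP 0 (s a b * K a v); last first.
  by rewrite le_eqVlt ltNge sK_ge0 orbF => /eqP ->; rewrite !mul0r.
have [s0 K0] := mul_gt0_factors sK0.
rewrite ler_pM2l// invrK ler_ln ?posrE ?mulr_gt0// ler_piMl//.
by case: (K_channel a) => _ <-; rewrite (bigD1 v)//= lerDl sumr_ge0.
Qed.

(** The log-sum inequality on each fibre of [h]: the ratios [K / posterior] are compared with the
    ratio of their fibre totals through [ln x >= 1 - 1/x]. *)
Lemma info_data_processing (V' : finType) (h : V -> V') :
  info s (fun a v' => \sum_(v | h v == v') K a v) <= info s K.
Proof.
set K' := fun a v' => _.
have out' b v' : out_mass s K' b v' = \sum_(v | h v == v') out_mass s K b v.
  by rewrite exchange_big/=; apply: eq_bigr => a _; rewrite mulr_sumr.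
have post' b v' : posterior s K' b v' = \sum_(v | h v == v') posterior s K b v.
  by rewrite /posterior out' mulr_suml.
rewrite /info /log_loss; apply: ler_sum => a _; apply: ler_sum => b _.
rewrite (partition_big h xpredT)//=; apply: ler_sum => v' _.
have K'0 v : 0 <= K' a v by apply: sumr_ge0.
have [sK'0|] := ltP 0 (s a b * K' a v'); last first.
  rewrite le_eqVlt ltNge mulr_ge0// orbF => /eqP sK'; rewrite sK' mul0r big1// => v hv.
  suff -> : s a b * K a v = 0 by rewrite mul0r.
  apply/eqP; rewrite eq_le sK_ge0 andbT -sK' ler_wpM2l//.
  by rewrite /K' (bigD1 v)//= lerDl sumr_ge0.
have p'0 : 0 < posterior s K' b v'.
  rewrite /posterior divr_gt0//.
    apply: lt_le_trans sK'0 _; rewrite /out_mass (bigD1 a)//= lerDl.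
    by apply: sumr_ge0 => a' _; rewrite mulr_ge0// sumr_ge0.
  apply: lt_le_trans (le_mass a b); rewrite lt_neqAle s_ge0 andbT eq_sym.
  by apply: contraTneq sK'0 => ->; rewrite mul0r ltxx.
have k'0 : 0 < K' a v'.
  rewrite lt_neqAle K'0 andbT eq_sym.
  by apply: contraTneq sK'0 => ->; rewrite mulr0 ltxx.
rewrite -subr_ge0 {1}/K' mulr_sumr mulr_suml -sumrB.
(* With this ratio of fibre totals, the lower bounds [s * (K - c * posterior)] cancel over the
   fibre. *)
set c := K' a v' / posterior s K' b v'.
have c0 : 0 < c by rewrite divr_gt0.
apply: (@le_trans _ _ (\sum_(v | h v == v') s a b * (K a v - c * posterior s K b v))).
  rewrite -mulr_sumr sumrB -mulr_sumr -post' -/(K' a v') /c divfK ?gt_eqF//.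
  by rewrite subrr mulr0.
clearbody c; apply: ler_sum => v _.
have [sK0|] := ltP 0 (s a b * K a v); last first.
  rewrite le_eqVlt ltNge sK_ge0 orbF mulrBr => /eqP ->.
  rewrite !mul0r subrr sub0r oppr_le0 mulr_ge0// mulr_ge0 ?posterior_ge0//.
  exact: ltW.
have [s0 K0] := mul_gt0_factors sK0; have p0 := posterior_gt0 sK0.
rewrite -!mulrA -mulrBr ler_pM2l// -mulrBr.
have -> : K a v - c * posterior s K b v =
    K a v * (1 - ((K a v / posterior s K b v) / c)^-1).
  rewrite invf_div mulrBr mulr1 invf_div; congr (_ - _).
  by field; rewrite gt_eqF.
have Kp0 : 0 < K a v / posterior s K b v by exact: divr_gt0.
by rewrite ler_pM2l// -ln_div ?posrE// ln_ge1BV//; exact: (divr_gt0 Kp0).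
Qed.

Lemma channel_push (V' : finType) (h : V -> V') :
  is_channel (fun a v' => \sum_(v | h v == v') K a v).
Proof.
move=> a; split=> [v'|]; first exact: sumr_ge0.
by case: (K_channel a) => _ <-; rewrite [RHS](partition_big h xpredT).
Qed.

Lemma cond_mutual_info_log2 :
  cond_mutual_info (fun v a b => s a b * K a v) = info s K / ln 2.
Proof.
rewrite /cond_mutual_info /info /log_loss mulr_suml exchange_big/=.
apply: eq_bigr => a _; rewrite mulr_suml exchange_big/=; apply: eq_bigr => b _.
rewrite mulr_suml; apply: eq_bigr => v _; rewrite /log2 mulrA; congr (_ / _).
have [sK0|] := ltP 0 (s a b * K a v); last first.
  by rewrite le_eqVlt ltNge sK_ge0 orbF => /eqP ->; rewrite !mul0r.
have [s0 K0] := mul_gt0_factors sK0.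
congr (_ * ln _).
rewrite exchange_big/= -/(out_mass s K b v).
have -> : \sum_j \sum_i s j b * K j i = mass s b.
  by rewrite exchange_big -sum_out_mass.
rewrite -mulr_sumr; case: (K_channel a) => _ ->; rewrite mulr1 /posterior.
have m0 : 0 < mass s b by apply: lt_le_trans (le_mass a b).
have o0 : 0 < out_mass s K b v by apply: lt_le_trans (le_out_mass a b v).
by field; rewrite !gt_eqF.
Qed.

End InfoBounds.

(** * Single-letterization *)

Lemma sum_pair (R : realType) (A B : finType) (F : A * B -> R) :
  \sum_p F p = \sum_a \sum_b F (a, b).
Proof. by rewrite pair_bigA; apply: eq_bigr => -[]. Qed.

Definition prod_source (R : realType) (A1 A2 B1 B2 : finType)
    (s1 : A1 -> B1 -> R) (s2 : A2 -> B2 -> R) (a : A1 * A2) (b : B1 * B2) : R :=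
  s1 a.1 b.1 * s2 a.2 b.2.

(** The auxiliary variable of the first letter is V together with the side information of the other
    letters. *)
Definition first_kernel (R : realType) (A1 A2 B2 V : finType)
    (s2 : A2 -> B2 -> R) (K : A1 * A2 -> V -> R) (a1 : A1) (p : B2 * V) : R :=
  \sum_a2 s2 a2 p.1 * K (a1, a2) p.2.

(** The auxiliary variable of the remaining letters is V together with the first source letter and
    its side information. Both are independent of the remaining letters, so adjoining them keeps the
    Markov chain. *)
Definition second_kernel (R : realType) (A1 B1 A2 V : finType)
    (s1 : A1 -> B1 -> R) (K : A1 * A2 -> V -> R) (a2 : A2)
    (p : A1 * B1 * V) : R :=
  s1 p.1.1 p.1.2 * K (p.1.1, a2) p.2.

Section TwoLetters.
Context (R : realType) (A1 A2 B1 B2 V : finType).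
Context (s1 : A1 -> B1 -> R) (s2 : A2 -> B2 -> R) (K : A1 * A2 -> V -> R).
Hypothesis s1_ge0 : forall a b, 0 <= s1 a b.
Hypothesis s2_ge0 : forall a b, 0 <= s2 a b.
Hypothesis K_channel : is_channel K.

Let K_ge0 a v : 0 <= K a v. Proof. by case: (K_channel a). Qed.

Lemma first_kernel_channel :
  \sum_a \sum_b s2 a b = 1 -> is_channel (first_kernel s2 K).
Proof.
move=> s21 a1; split=> [p|]; first by apply: sumr_ge0 => a2 _; rewrite mulr_ge0.
rewrite sum_pair -s21 [RHS]exchange_big/=; apply: eq_bigr => b2 _.
rewrite exchange_big/=; apply: eq_bigr => a2 _.
by rewrite -mulr_sumr; case: (K_channel (a1, a2)) => _ ->; rewrite mulr1.
Qed.

Lemma second_kernel_channel :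
  \sum_a \sum_b s1 a b = 1 -> is_channel (second_kernel s1 K).
Proof.
move=> s11 a2; split=> [p|]; first by rewrite mulr_ge0.
rewrite !sum_pair -s11; apply: eq_bigr => a1 _; apply: eq_bigr => b1 _.
by rewrite /second_kernel/= -mulr_sumr; case: (K_channel (a1, a2)) => _ ->; rewrite mulr1.
Qed.

(* The chain rule holds term by term: the first log-ratio is K1 / (q12 * m2)
   and the second K * m2 / K1, where q12 is the posterior of K and m2 the
   marginal of s2 on B2. *)
Lemma info_prod_source : info (prod_source s1 s2) K =
  info s1 (first_kernel s2 K) + info s2 (second_kernel s1 K).
Proof.
have -> : info (prod_source s1 s2) K = \sum_a1 \sum_b1 \sum_a2 \sum_b2 \sum_v
    s1 a1 b1 * s2 a2 b2 * K (a1, a2) v *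
    ln (K (a1, a2) v / posterior (prod_source s1 s2) K (b1, b2) v).
  rewrite /info /log_loss sum_pair; apply: eq_bigr => a1 _.
  by under eq_bigr do rewrite sum_pair; rewrite exchange_big.
have -> : info s1 (first_kernel s2 K) = \sum_a1 \sum_b1 \sum_a2 \sum_b2 \sum_v
    s1 a1 b1 * s2 a2 b2 * K (a1, a2) v *
    ln (first_kernel s2 K a1 (b2, v) / posterior s1 (first_kernel s2 K) b1 (b2, v)).
  rewrite /info /log_loss; apply: eq_bigr => a1 _; apply: eq_bigr => b1 _.
  rewrite sum_pair [RHS]exchange_big/=; apply: eq_bigr => b2 _.
  rewrite [RHS]exchange_big/=; apply: eq_bigr => v _.
  rewrite {1}/first_kernel/= mulr_sumr mulr_suml; apply: eq_bigr => a2 _.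
  by rewrite mulrA.
have -> : info s2 (second_kernel s1 K) = \sum_a1 \sum_b1 \sum_a2 \sum_b2 \sum_v
    s1 a1 b1 * s2 a2 b2 * K (a1, a2) v *
    ln (second_kernel s1 K a2 (a1, b1, v)
        / posterior s2 (second_kernel s1 K) b2 (a1, b1, v)).
  rewrite /info /log_loss; under eq_bigr do under eq_bigr do rewrite sum_pair.
  under eq_bigr do rewrite exchange_big/=.
  rewrite exchange_big/= sum_pair; apply: eq_bigr => a1 _; apply: eq_bigr => b1 _.
  apply: eq_bigr => a2 _; apply: eq_bigr => b2 _; apply: eq_bigr => v _.
  by rewrite {1}/second_kernel/=; congr (_ * _); ring.
rewrite -big_split; apply: eq_bigr => a1 _; rewrite -big_split.
apply: eq_bigr => b1 _; rewrite -big_split; apply: eq_bigr => a2 _.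
rewrite -big_split; apply: eq_bigr => b2 _; rewrite -big_split.
apply: eq_bigr => v _ /=.
have [w0|] := ltP 0 (s1 a1 b1 * s2 a2 b2 * K (a1, a2) v); last first.
  by rewrite le_eqVlt ltNge !mulr_ge0// orbF => /eqP ->; rewrite !mul0r addr0.
have /and3P[s10 s20 K0] : [&& 0 < s1 a1 b1, 0 < s2 a2 b2 & 0 < K (a1, a2) v].
  rewrite !lt_neqAle s1_ge0 s2_ge0 K_ge0 !andbT.
  by apply/and3P; split; apply: contraTneq w0 => <-;
    rewrite ?(mul0r, mulr0) ltxx.
have m1 : 0 < mass s1 b1 by apply: lt_le_trans (le_mass s1_ge0 a1 b1).
have m2 : 0 < mass s2 b2 by apply: lt_le_trans (le_mass s2_ge0 a2 b2).
have K10 : 0 < first_kernel s2 K a1 (b2, v).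
  rewrite /first_kernel (bigD1 a2)//= ltr_pwDl ?mulr_gt0// sumr_ge0// => *.
  exact: mulr_ge0.
have k1_ge0 a p : 0 <= first_kernel s2 K a p.
  by apply: sumr_ge0 => *; rewrite mulr_ge0.
have o0 : 0 < out_mass s1 (first_kernel s2 K) b1 (b2, v).
  rewrite /out_mass (bigD1 a1)//= ltr_pwDl ?mulr_gt0// sumr_ge0// => *.
  exact: mulr_ge0.
have -> : posterior (prod_source s1 s2) K (b1, b2) v =
    out_mass s1 (first_kernel s2 K) b1 (b2, v) / (mass s1 b1 * mass s2 b2).
  rewrite /posterior; congr (_ / _).
    rewrite /out_mass sum_pair; apply: eq_bigr => a _; rewrite mulr_sumr.
    by apply: eq_bigr => a' _; rewrite mulrA.
  rewrite /mass sum_pair mulr_suml; apply: eq_bigr => a _.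
  by rewrite mulr_sumr.
have -> : posterior s2 (second_kernel s1 K) b2 (a1, b1, v) =
    s1 a1 b1 * first_kernel s2 K a1 (b2, v) / mass s2 b2.
  rewrite /posterior; congr (_ / _); rewrite /out_mass mulr_sumr.
  by apply: eq_bigr => a _; rewrite mulrCA.
rewrite /posterior -mulrDr -lnM ?posrE ?divr_gt0 ?mulr_gt0//; congr (_ * ln _).
by rewrite /second_kernel/=; field; rewrite !gt_eqF.
Qed.

End TwoLetters.

Lemma info_reindex (R : realType) (A A' B B' V : finType)
    (s : A -> B -> R) (K : A -> V -> R) (f : A' -> A) (g : B' -> B) :
  bijective f -> bijective g ->
  info s K = info (fun a b => s (f a) (g b)) (fun a v => K (f a) v).
Proof.
move=> bf bg; have rf := onW_bij predT bf; have rg := onW_bij predT bg.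
rewrite /info /log_loss (reindex f)//=; apply: eq_bigr => a _.
rewrite (reindex g)//=; apply: eq_bigr => b _; apply: eq_bigr => v _.
by rewrite /posterior /out_mass /mass !(reindex f (P := predT))//=.
Qed.

(** * Time sharing between two test channels *)

Definition single_distortion (R : realType) (Y Z Xt U : finType) (s : Y -> Z -> R)
    (delta : Y -> Z -> Xt -> R) (K : Y -> U -> R) (xt : U -> Z -> Xt) : R :=
  \sum_y \sum_z \sum_u s y z * K y u * delta y z (xt u z).

(** The tag of the disjoint sum is independent of (Y, Z), and its weight cancels in [K / posterior];
    hence both quantities are exactly affine. *)
Lemma time_sharing (R : realType) (Y Z Xt U1 U2 : finType) (s : Y -> Z -> R)
    (delta : Y -> Z -> Xt -> R) (l1 l2 : R)
    (K1 : Y -> U1 -> R) (xt1 : U1 -> Z -> Xt)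
    (K2 : Y -> U2 -> R) (xt2 : U2 -> Z -> Xt) :
  0 < l1 -> 0 < l2 -> l1 + l2 = 1 -> is_channel K1 -> is_channel K2 ->
  exists (U : finType) (K : Y -> U -> R) (xt : U -> Z -> Xt),
    [/\ is_channel K, info s K = l1 * info s K1 + l2 * info s K2 &
        single_distortion s delta K xt = l1 * single_distortion s delta K1 xt1 +
          l2 * single_distortion s delta K2 xt2].
Proof.
move=> l10 l20 l12 K1c K2c.
exists (U1 + U2)%type, (fun y u => match u with
  | inl u1 => l1 * K1 y u1 | inr u2 => l2 * K2 y u2 end),
  (fun u => match u with inl u1 => xt1 u1 | inr u2 => xt2 u2 end).
set K := (K in is_channel K); split.
- move=> y; split=> [[u|u]|]; rewrite ?mulr_ge0 ?(ltW l10) ?(ltW l20)//=.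
  + by case: (K1c y).
  + by case: (K2c y).
  + rewrite big_sumType/= -!mulr_sumr.
    by case: (K1c y) => _ ->; case: (K2c y) => _ ->; rewrite !mulr1.
- rewrite /info /log_loss !mulr_sumr -big_split; apply: eq_bigr => y _ /=.
  rewrite !mulr_sumr -big_split; apply: eq_bigr => z _ /=.
  rewrite big_sumType/= !mulr_sumr; congr (_ + _); apply: eq_bigr => u _;
    rewrite -!mulrA mulrCA; congr (_ * (_ * (_ * ln _)));
    rewrite /posterior /out_mass/=.
  + have -> : \sum_a s a z * (l1 * K1 a u) = l1 * \sum_a s a z * K1 a u.
      by rewrite mulr_sumr; apply: eq_bigr => *; rewrite mulrCA.
    rewrite -(mulrA l1 _ (mass s z)^-1) invfM mulrCA (mulrA l1) mulfV ?gt_eqF//.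
    by rewrite mul1r.
  + have -> : \sum_a s a z * (l2 * K2 a u) = l2 * \sum_a s a z * K2 a u.
      by rewrite mulr_sumr; apply: eq_bigr => *; rewrite mulrCA.
    rewrite -(mulrA l2 _ (mass s z)^-1) invfM mulrCA (mulrA l2) mulfV ?gt_eqF//.
    by rewrite mul1r.
- rewrite /single_distortion !mulr_sumr -big_split; apply: eq_bigr => y _ /=.
  rewrite !mulr_sumr -big_split; apply: eq_bigr => z _ /=.
  rewrite big_sumType/= !mulr_sumr; congr (_ + _); apply: eq_bigr => u _; ring.
Qed.

(** * Words split into a first letter and a tail *)

Definition wcons (T : finType) (n : nat) (t : T) (w : word n T) : word n.+1 T :=
  [ffun i => oapp w t (unlift ord0 i)].

Definition wtail (T : finType) (n : nat) (w : word n.+1 T) : word n T :=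
  [ffun i => w (lift ord0 i)].

Lemma wcons0 (T : finType) n (t : T) (w : word n T) : wcons t w ord0 = t.
Proof. by rewrite ffunE unlift_none. Qed.

Lemma wconsS (T : finType) n (t : T) (w : word n T) i :
  wcons t w (lift ord0 i) = w i.
Proof. by rewrite ffunE liftK. Qed.

Lemma wcons_bij (T : finType) n :
  bijective (fun p : T * word n T => wcons p.1 p.2).
Proof.
exists (fun w : word n.+1 T => (w ord0, wtail w)) => [[t w]|w] /=.
  by rewrite wcons0; congr pair; apply/ffunP => i; rewrite ffunE wconsS.
apply/ffunP => i; case: (unliftP ord0 i) => [j ->|->]; last exact: wcons0.
by rewrite wconsS ffunE.
Qed.

Lemma sum_wcons (R : realType) (T : finType) n (F : word n.+1 T -> R) :
  \sum_w F w = \sum_t \sum_w F (wcons t w).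
Proof.
rewrite (reindex (fun p : T * word n T => wcons p.1 p.2)) ?sum_pair//.
exact: onW_bij (wcons_bij T n).
Qed.

Definition word_source (R : realType) (A B : finType) (s : A -> B -> R) n
    (a : word n A) (b : word n B) : R :=
  \prod_i s (a i) (b i).

Lemma word_source_ge0 (R : realType) (A B : finType) (s : A -> B -> R) n :
  (forall a b, 0 <= s a b) ->
  forall (a : word n A) b, 0 <= word_source s a b.
Proof. by move=> s0 a b; apply: prodr_ge0. Qed.

Lemma word_source_cons (R : realType) (A B : finType) (s : A -> B -> R) n
    a (w : word n A) b (w' : word n B) :
  word_source s (wcons a w) (wcons b w') = s a b * word_source s w w'.
Proof.
rewrite /word_source big_ord_recl !wcons0; congr (_ * _).
by apply: eq_bigr => i _; rewrite !wconsS.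
Qed.

Lemma sum_word_source (R : realType) (A B : finType) (s : A -> B -> R) n :
  \sum_a \sum_b s a b = 1 ->
  \sum_(a : word n A) \sum_(b : word n B) word_source s a b = 1.
Proof.
move=> s1; rewrite /word_source.
transitivity (\sum_(a : word n A) \prod_i \sum_b s (a i) b).
  by apply: eq_bigr => a _; rewrite bigA_distr_bigA.
rewrite -(bigA_distr_bigA (fun (i : 'I_n) a => \sum_b s a b)).
by rewrite big1.
Qed.

(** The distortion is summed rather than averaged over the letters, so that peeling off a letter
    splits it additively. *)
Definition word_cost (R : realType) (Y Z Xt V : finType) (s : Y -> Z -> R)
    (delta : Y -> Z -> Xt -> R) n (K : word n Y -> V -> R)
    (g : V -> word n Z -> word n Xt) : R :=
  \sum_y \sum_z \sum_v
    word_source s y z * K y v * \sum_i delta (y i) (z i) (g v z i).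

Lemma info_wcons (R : realType) (Y Z V : finType) (s : Y -> Z -> R) n
    (K : word n.+1 Y -> V -> R) :
  info (@word_source _ _ _ s n.+1) K =
  info (prod_source s (@word_source _ _ _ s n)) (fun p => K (wcons p.1 p.2)).
Proof.
rewrite (info_reindex _ _ (wcons_bij Y n) (wcons_bij Z n)); congr info.
by apply/funext => -[y y']; apply/funext => -[z z'] /=; rewrite word_source_cons.
Qed.

(** Each of the two auxiliary variables contains the missing part of the side information, so either
    decoder can rebuild the whole word [z] and run [g] on it. *)
Lemma word_cost_wcons (R : realType) (Y Z Xt V : finType) (s : Y -> Z -> R)
    (delta : Y -> Z -> Xt -> R) n (K : word n.+1 Y -> V -> R)
    (g : V -> word n.+1 Z -> word n.+1 Xt) :
  let K' (p : Y * word n Y) := K (wcons p.1 p.2) in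
  word_cost s delta K g =
  single_distortion s delta (first_kernel (@word_source _ _ _ s n) K')
    (fun p z => g p.2 (wcons z p.1) ord0) +
  word_cost s delta (second_kernel s K')
    (fun p z' => wtail (g p.2 (wcons p.1.2 z'))).
Proof.
move=> K'; rewrite /word_cost /single_distortion.
have -> : \sum_y \sum_z \sum_v word_source s y z * K y v *
      (\sum_i delta (y i) (z i) (g v z i)) =
    \sum_y \sum_z \sum_y' \sum_z' \sum_v s y z * word_source s y' z' *
      K (wcons y y') v * (delta y z (g v (wcons z z') ord0) +
        \sum_i delta (y' i) (z' i) (wtail (g v (wcons z z')) i)).
  rewrite sum_wcons; apply: eq_bigr => y _; rewrite [RHS]exchange_big/=.
  apply: eq_bigr => y' _; rewrite sum_wcons; apply: eq_bigr => z _.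
  apply: eq_bigr => z' _; apply: eq_bigr => v _; rewrite word_source_cons.
  congr (_ * _); rewrite big_ord_recl !wcons0; congr (_ + _).
  by apply: eq_bigr => i _; rewrite !wconsS ffunE.
have -> : \sum_y \sum_z \sum_(u : word n Z * V) s y z *
      first_kernel (@word_source _ _ _ s n) K' y u *
      delta y z (g u.2 (wcons z u.1) ord0) =
    \sum_y \sum_z \sum_y' \sum_z' \sum_v s y z * word_source s y' z' *
      K (wcons y y') v * delta y z (g v (wcons z z') ord0).
  apply: eq_bigr => y _; apply: eq_bigr => z _; rewrite sum_pair.
  rewrite [RHS]exchange_big/=; apply: eq_bigr => z' _.
  rewrite [RHS]exchange_big/=; apply: eq_bigr => v _.
  rewrite /first_kernel/= mulr_sumr mulr_suml; apply: eq_bigr => y' _.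
  by rewrite mulrA.
have -> : \sum_y' \sum_z' \sum_(u : Y * Z * V) word_source s y' z' *
      second_kernel s K' y' u *
      (\sum_i delta (y' i) (z' i) (wtail (g u.2 (wcons u.1.2 z')) i)) =
    \sum_y \sum_z \sum_y' \sum_z' \sum_v s y z * word_source s y' z' *
      K (wcons y y') v *
      (\sum_i delta (y' i) (z' i) (wtail (g v (wcons z z')) i)).
  under eq_bigr do under eq_bigr do rewrite sum_pair.
  under eq_bigr do rewrite exchange_big/=.
  rewrite exchange_big/= sum_pair; apply: eq_bigr => y _; apply: eq_bigr => z _.
  apply: eq_bigr => y' _; apply: eq_bigr => z' _; apply: eq_bigr => v _.
  by rewrite /second_kernel/=; congr (_ * _); rewrite mulrA (mulrC (word_source _ _ _)).
rewrite -big_split; apply: eq_bigr => y _; rewrite -big_split.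
apply: eq_bigr => z _; rewrite -big_split; apply: eq_bigr => y' _.
rewrite -big_split; apply: eq_bigr => z' _; rewrite -big_split.
by apply: eq_bigr => v _; rewrite mulrDr.
Qed.

(** Induction on the length: the chain rule separates the first letter from the tail, the induction
    hypothesis treats the tail, and time sharing merges the two test channels. *)
Lemma single_letterize (R : realType) (Y Z Xt : finType) (s : Y -> Z -> R)
    (delta : Y -> Z -> Xt -> R) (n : nat) (V : finType)
    (K : word n.+1 Y -> V -> R) (g : V -> word n.+1 Z -> word n.+1 Xt) :
  (forall y z, 0 <= s y z) -> \sum_y \sum_z s y z = 1 -> is_channel K ->
  exists (U : finType) (PU : Y -> U -> R) (xt : U -> Z -> Xt),
    [/\ is_channel PU, n.+1%:R * info s PU <= info (@word_source _ _ _ s n.+1) K &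
        n.+1%:R * single_distortion s delta PU xt <= word_cost s delta K g].
Proof.
move=> s_ge0 s1.
have pairc m (W : finType) (L : word m.+1 Y -> W -> R) : is_channel L ->
    is_channel (fun p : Y * word m Y => L (wcons p.1 p.2)) by move=> Lc p.
elim: n V K g => [|n IHn] V K g K_channel; have K'c := pairc _ _ _ K_channel;
  rewrite info_wcons word_cost_wcons
    (info_prod_source s_ge0 (word_source_ge0 s_ge0) K'c);
  set K1 := first_kernel _ _; set K2 := second_kernel _ _;
  have K1c : is_channel K1 by apply: first_kernel_channel => //;
    [exact: word_source_ge0|exact: sum_word_source].
  exists (word 0 Z * V)%type, K1, (fun p z => g p.2 (wcons z p.1) ord0).
  split=> //; rewrite mul1r lerDl; first last.
    apply: sumr_ge0 => y _; apply: sumr_ge0 => z _; apply: sumr_ge0 => v _.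
    by rewrite big_ord0 mulr0.
  apply: info_ge0; first exact: word_source_ge0.
  exact: second_kernel_channel.
have K2c : is_channel K2 by exact: second_kernel_channel.
have [U2 [PU2 [xt2 [PU2c I2 D2]]]] := IHn _ K2
  (fun p z' => wtail (g p.2 (wcons p.1.2 z'))) K2c.
have n0 : 0 < n.+2%:R :> R by rewrite ltr0n.
have n1 : 0 < n.+1%:R :> R by rewrite ltr0n.
have l2 : n.+2%:R = n.+1%:R + 1 :> R by rewrite -natr1.
(* The weights are proportional to the numbers of letters, 1 and [n.+1]; multiplying by [n.+2] turns
   the averages back into sums. *)
have [|||U [PU [xt [PUc I D]]]] := time_sharing s delta (l1 := n.+2%:R^-1)
  (l2 := n.+1%:R / n.+2%:R) (fun p z => g p.2 (wcons z p.1) ord0) xt2 _ _ _ K1c PU2c.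
- by rewrite invr_gt0.
- by rewrite divr_gt0.
- by rewrite l2; field; rewrite gt_eqF// -l2.
exists U, PU, xt; split=> //.
  rewrite I mulrDr mulrA mulfV ?gt_eqF// mul1r lerD2l.
  by rewrite mulrA mulrCA mulfV ?gt_eqF// mulr1.
rewrite D mulrDr mulrA mulfV ?gt_eqF// mul1r lerD2l.
by rewrite mulrA mulrCA mulfV ?gt_eqF// mulr1.
Qed.

(** * Compactness of test channels *)

Lemma xlnx_continuous (R : realType) : continuous (fun x : R => x * ln x).
Proof.
move=> x; have [x0|x0] := leP x 0; last first.
  by apply: cvgM; [exact: cvg_id|exact: continuous_ln].
rewrite /continuous_at (ln0 x0) mulr0; apply/cvgr0Pnorm_lt => e e0.
(* For [y = t ^ 2] the bound [t * ln t >= t - 1] gives [- y * ln y <= 2 * t * (1 - t)], which is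
   below [e] once [t < e / 2]. For [y <= 0] the convention [ln y = 0] applies. *)
have e20 : 0 < (e / 2) ^+ 2 by rewrite exprn_gt0// divr_gt0.
near=> y.
have y1 : y < 1 by near: y; apply: lt_nbhsl; exact: le_lt_trans x0 ltr01.
have ye : y < (e / 2) ^+ 2 by near: y; apply: lt_nbhsl; exact: le_lt_trans x0 e20.
have [y0|y0] := leP y 0; first by rewrite ln0// mulr0 normr0.
pose t := Num.sqrt y.
have t0 : 0 < t by rewrite sqrtr_gt0.
have yt : y = t ^+ 2 by rewrite sqr_sqrtr// ltW.
have te : t < e / 2 by rewrite -ltr_sqr ?nnegrE ?ltW ?divr_gt0// -yt.
rewrite ler0_norm ?mulr_ge0_le0 ?ln_le0 ?ltW//.
have := ln_ge1BV t0; rewrite yt lnXn// mulr2n => lnt.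
have : t * (1 - t^-1) <= t * ln t by rewrite ler_pM2l.
rewrite mulrBr mulr1 divff ?gt_eqF// expr2 => h.
have : t * (t - 1) <= t * (t * ln t) by rewrite ler_pM2l.
have : 0 < t * t by rewrite mulr_gt0.
by nra.
Unshelve. all: by end_near. Qed.

Lemma continuous_sumr (R : realType) (T : topologicalType) (I : finType)
    (F : I -> T -> R) :
  (forall i, continuous (F i)) -> continuous (fun t => \sum_i F i t).
Proof.
by move=> cF; apply: continuous_big => // -[x y]; exact: add_continuous.
Qed.

Lemma continuous_addr (R : realType) (T : topologicalType) (f g : T -> R) :
  continuous f -> continuous g -> continuous (fun t => f t + g t).
Proof. by move=> cf cg t; apply: cvgD; [exact: cf|exact: cg]. Qed.

Lemma continuous_cstM (R : realType) (T : topologicalType) (a : R) (f : T -> R) :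
  continuous f -> continuous (fun t => a * f t).
Proof. by move=> cf t; apply: cvgM; [exact: cvg_cst|exact: cf]. Qed.

Lemma continuous_normr (R : realType) (T : topologicalType) (f : T -> R) :
  continuous f -> continuous (fun t => `|f t|).
Proof.
by move=> cf t; apply: (continuous_comp (cf t)); exact: (@norm_continuous R R).
Qed.

Lemma continuous_xlnx (R : realType) (T : topologicalType) (f : T -> R) :
  continuous f -> continuous (fun t => f t * ln (f t)).
Proof.
move=> cf t; apply: (@continuous_comp _ _ _ f (fun x : R => x * ln x) t (cf t)).
exact: xlnx_continuous.
Qed.

(* The form of [info] that is visibly continuous in the kernel. *)
Definition entropy_form (R : realType) (A B V : finType) (s : A -> B -> R)
    (K : A -> V -> R) : R :=
  \sum_a \sum_b \sum_v s a b * (K a v * ln (K a v)) +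
  (\sum_b \sum_v (-1) * (out_mass s K b v * ln (out_mass s K b v)) +
   \sum_b \sum_v ln (mass s b) * out_mass s K b v).

Lemma info_entropy_form (R : realType) (A B V : finType) (s : A -> B -> R)
    (K : A -> V -> R) :
  (forall a b, 0 <= s a b) -> is_channel K -> info s K = entropy_form s K.
Proof.
move=> s_ge0 Kc; have K_ge0 a v : 0 <= K a v by case: (Kc a).
rewrite /entropy_form -big_split.
under [X in _ + X]eq_bigr do rewrite -big_split.
have -> : \sum_b \sum_v (-1 * (out_mass s K b v * ln (out_mass s K b v)) +
      ln (mass s b) * out_mass s K b v) =
    \sum_a \sum_b \sum_v s a b * K a v *
      (ln (mass s b) - ln (out_mass s K b v)).
  rewrite [RHS]exchange_big; apply: eq_bigr => b _.
  rewrite [RHS]exchange_big; apply: eq_bigr => v _ /=.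
  by rewrite -mulr_suml -/(out_mass s K b v); ring.
rewrite -big_split; apply: eq_bigr => a _; rewrite -big_split.
apply: eq_bigr => b _; rewrite -big_split; apply: eq_bigr => v _ /=.
have [sK0|] := ltP 0 (s a b * K a v); last first.
  by rewrite mulrA le_eqVlt ltNge mulr_ge0// orbF => /eqP ->; rewrite !mul0r addr0.
have [s0 K0] := mul_gt0_factors s_ge0 Kc sK0.
have m0 : 0 < mass s b by apply: lt_le_trans (le_mass s_ge0 a b).
have o0 : 0 < out_mass s K b v by apply: lt_le_trans (le_out_mass s_ge0 Kc a b v).
rewrite /posterior (ln_div (x := K a v)) ?posrE ?divr_gt0// ln_div ?posrE//.
by ring.
Qed.

Section Limit.
Context (R : realType) (Y Z Xt : finType) (s : Y -> Z -> R).
Context (delta : Y -> Z -> Xt -> R) (r D : R).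
Hypothesis s_ge0 : forall y z, 0 <= s y z.

Notation F := {ffun Z -> Xt}.
Notation N := #|{: Y * F}|.

(** The distortion depends on [u] only through the decoding function [xt u], so U may be replaced by
    that function, and data processing does not increase the information. The alphabet no longer
    varies with the kernel, as compactness requires. *)
Lemma reduce_alphabet (U : finType) (K : Y -> U -> R) (xt : U -> Z -> Xt) :
  is_channel K -> exists K' : Y -> F -> R,
    [/\ is_channel K', info s K' <= info s K &
        single_distortion s delta K' (fun f z => f z) =
        single_distortion s delta K xt].
Proof.
move=> Kc; pose h u : F := [ffun z => xt u z].
exists (fun y f => \sum_(u | h u == f) K y u); split.
- exact: channel_push.
- exact: info_data_processing.
- apply: eq_bigr => y _; apply: eq_bigr => z _.
  rewrite [RHS](partition_big h xpredT)//=; apply: eq_bigr => f _.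
  rewrite mulr_sumr mulr_suml; apply: eq_bigr => u /eqP <-.
  by rewrite ffunE.
Qed.

Let kern (v : 'rV[R]_N) (y : Y) (f : F) : R := v ord0 (enum_rank (y, f)).

(** Nonnegative, and on the unit cube zero exactly at the kernels meeting both constraints, since
    [|x| + x] is twice the positive part. [entropy_form] replaces [info] because it is continuous on
    all vectors. *)
Let penalty (v : 'rV[R]_N) : R :=
  let D' := single_distortion s delta (kern v) (fun f z => f z) + - D in
  let r' := entropy_form s (kern v) + - r in
  \sum_y `|\sum_f kern v y f + (-1)| + ((`|D'| + D') + (`|r'| + r')).

Let penalty_continuous : continuous penalty.
Proof.
have ck y f : continuous (fun v => kern v y f) by exact: coord_continuous.
have cst (a : R) : continuous (fun _ : 'rV[R]_N => a) by exact: cst_continuous.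
have cpos (g : 'rV[R]_N -> R) : continuous g -> continuous (fun v => `|g v| + g v).
  by move=> cg; apply: continuous_addr => //; exact: continuous_normr.
have co z f : continuous (fun v => out_mass s (kern v) z f).
  by apply: continuous_sumr => y; exact: continuous_cstM.
apply: continuous_addr; last apply: continuous_addr; [|apply: cpos..].
- apply: continuous_sumr => y; apply: continuous_normr; apply: continuous_addr => //.
  exact: continuous_sumr.
- apply: continuous_addr => //; apply: continuous_sumr => y.
  apply: continuous_sumr => z; apply: continuous_sumr => f.
  under [X in continuous X]eq_fun do rewrite mulrAC.
  exact: continuous_cstM.
- apply: continuous_addr => //; apply: continuous_addr; last apply: continuous_addr.
  + apply: continuous_sumr => y; apply: continuous_sumr => z.
    by apply: continuous_sumr => f; apply: continuous_cstM; exact: continuous_xlnx.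
  + apply: continuous_sumr => z; apply: continuous_sumr => f.
    by apply: continuous_cstM; exact: continuous_xlnx.
  + apply: continuous_sumr => z; apply: continuous_sumr => f.
    exact: continuous_cstM.
Qed.

(** The continuous [penalty] attains its minimum on the compact cube; the approximate kernels make
    that minimum at most every [e > 0], so a minimizer satisfies the constraints exactly. *)
Lemma limit_kernel :
  (forall eps : R, 0 < eps ->
    exists (U : finType) (K : Y -> U -> R) (xt : U -> Z -> Xt),
    [/\ is_channel K, info s K <= r & single_distortion s delta K xt <= D + eps]) ->
  exists K : Y -> F -> R,
    [/\ is_channel K, info s K <= r &
        single_distortion s delta K (fun f z => f z) <= D].
Proof.
move=> approx.
pose box := [set v : 'rV[R]_N | forall i, `[0, 1]%classic (v ord0 i)].
have cbox : compact box.
  apply: (@rV_compact R _ (fun _ => `[0, 1]%classic)) => _.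
  exact: segment_compact.
have box0 : box !=set0.
  by exists 0 => i /=; rewrite mxE in_itv/= lexx ler01.
have [c /[1!inE] cbox' cmin] := EVT_min_rV box0 cbox
  (continuous_subspaceT penalty_continuous).
have pos0 (x : R) : 0 <= `|x| + x by rewrite -lerBlDr sub0r -normrN ler_norm.
have pen0 : penalty c <= 0.
  apply/ler_addgt0Pl => e e0.
  (* Half of [e], because [|x| + x] doubles the excess distortion. *)
  have [|U [K0 [xt [K0c K0I K0D]]]] := approx (e / 2); first by rewrite divr_gt0.
  have [K [Kc KI KD]] := reduce_alphabet xt K0c.
  pose v : 'rV[R]_N := \row_i K (enum_val i).1 (enum_val i).2.
  have kv : kern v = K.
    by apply/funext => y; apply/funext => f; rewrite /kern mxE enum_rankK.
  have vbox : box v.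
    move=> i /=; rewrite mxE in_itv/=; case: (Kc (enum_val i).1) => K_ge0 K1.
    by rewrite K_ge0 -K1 (bigD1 (enum_val i).2)//= lerDl sumr_ge0.
  rewrite addr0; apply: (le_trans (cmin v _)); first by rewrite inE.
  rewrite /penalty kv big1 ?add0r => [|y _]; last first.
    by case: (Kc y) => _ ->; rewrite subrr normr0.
  rewrite -info_entropy_form// KD.
  have pos_le (x a : R) : 0 <= a -> x <= a -> `|x| + x <= a + a.
    by move=> a0 xa; have [?|?] := leP 0 x; [rewrite ger0_norm|rewrite ltr0_norm]; lra.
  have h1 := @pos_le (info s K - r) 0 (lexx _).
  have h2 := @pos_le (single_distortion s delta K0 xt - D) (e / 2).
  have h3 : info s K - r <= 0 by rewrite subr_le0 (le_trans KI).
  have h4 : single_distortion s delta K0 xt - D <= e / 2 by rewrite lerBlDl.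
  have h5 : 0 <= e / 2 by rewrite ltW// divr_gt0.
  by move: (h1 h3) (h2 h5 h4); lra.
move: pen0; rewrite /penalty.
set S := \sum_y _; set D' := _ + - D; set r' := _ + - r => pen0.
have S0 : 0 <= S by apply: sumr_ge0.
have [D0 r0] := (pos0 D', pos0 r').
have le0 (x : R) : `|x| + x <= 0 -> x <= 0 by move=> ?; have := normr_ge0 x; lra.
have Kc : is_channel (kern c).
  move=> y; split=> [f|]; first by have := cbox' (enum_rank (y, f)); rewrite /= in_itv/= => /andP[].
  have : S = 0 by apply/eqP; rewrite eq_le S0 andbT; lra.
  move/eqP; rewrite psumr_eq0// => /allP/(_ y).
  by rewrite mem_index_enum => /(_ isT); rewrite normr_eq0 subr_eq0 => /eqP.
exists (kern c); split=> //.
  by rewrite info_entropy_form// -subr_le0; apply: le0; rewrite -/r'; lra.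
by rewrite -subr_le0; apply: le0; rewrite -/D'; lra.
Qed.

End Limit.

(** * The converse *)

Definition yz_source (R : realType) (X Y Z J : finType)
    (PX : X -> R) (W : X * J -> Y * Z -> R) (Q : X -> J -> R)
    (y : Y) (z : Z) : R :=
  \sum_x \sum_j joint PX W Q x j y z.

Definition iid_adversary (R : realType) (X J : finType) (Q : X -> J -> R) n
    (x : word n X) (j : word n J) : R :=
  \prod_i Q (x i) (j i).

(* [d] averaged over [X] given [Y = y, Z = z] turns the remote source into a
   direct one; the value is 0/0 = 0 where the source vanishes. *)
Definition remote_distortion (R : realType) (X Y Z J Xt : finType)
    (PX : X -> R) (W : X * J -> Y * Z -> R) (d : X -> Xt -> R) (Q : X -> J -> R)
    (y : Y) (z : Z) (xt : Xt) : R :=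
  (\sum_x \sum_j joint PX W Q x j y z * d x xt) / yz_source PX W Q y z.

Lemma exchange_sum2 (R : realType) (I1 I2 I3 I4 : finType)
    (F : I1 -> I2 -> I3 -> I4 -> R) :
  \sum_a \sum_b \sum_c \sum_e F a b c e = \sum_c \sum_e \sum_a \sum_b F a b c e.
Proof.
rewrite pair_bigA/= exchange_big/=; apply: eq_bigr => c _.
rewrite exchange_big/=; apply: eq_bigr => e _.
by rewrite (pair_bigA _ (fun a b => F a b c e)).
Qed.

Lemma sum_prod_words (R : realType) (A B : finType) n (F : 'I_n -> A -> B -> R) :
  \sum_(a : word n A) \sum_(b : word n B) \prod_i F i (a i) (b i) =
  \prod_i \sum_a \sum_b F i a b.
Proof.
rewrite (bigA_distr_bigA (fun (i : 'I_n) a => \sum_b F i a b)).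
by apply: eq_bigr => a _; rewrite bigA_distr_bigA.
Qed.

Lemma iid_adversary_channel (R : realType) (X J : finType) (Q : X -> J -> R) n :
  is_channel Q -> is_channel (@iid_adversary _ _ _ Q n).
Proof.
move=> Qc x; split=> [j|]; first by apply: prodr_ge0 => i _; case: (Qc (x i)).
rewrite /iid_adversary -(bigA_distr_bigA (fun i j => Q (x i) j)) big1// => i _.
by case: (Qc (x i)).
Qed.

(** This derandomizes a code: some deterministic code in the mixture does no worse than the
    average. *)
Lemma mean_le_exists (R : realType) (T : finType) (p f : T -> R) (a : R) :
  is_dist p -> \sum_t p t * f t <= a -> exists t, f t <= a.
Proof.
move=> [p_ge0 p1] fa; apply: contrapT => /forallNP nf.
have lt_af t : a < f t by rewrite ltNge; apply/negP/nf.
have [t pt0] : exists t, 0 < p t.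
  apply: contrapT => /forallNP np; have : (1 : R) = 0 => [|/eqP]; last by rewrite oner_eq0.
  by rewrite -p1 big1// => t _; apply/eqP; rewrite eq_le p_ge0 leNgt andbT; apply/negP/np.
have : 0 < \sum_t p t * (f t - a).
  rewrite (bigD1 t)//= ltr_pwDl ?mulr_gt0 ?subr_gt0// sumr_ge0// => *.
  by rewrite mulr_ge0// subr_ge0 ltW.
under eq_bigr do rewrite mulrBr.
by rewrite sumrB -mulr_suml p1 mul1r subr_gt0 ltNge fa.
Qed.

Lemma mean_le (R : realType) (T : finType) (p f : T -> R) (a : R) :
  is_dist p -> (forall t, f t <= a) -> \sum_t p t * f t <= a.
Proof.
move=> [p_ge0 p1] fa; apply: (@le_trans _ _ (\sum_t p t * a)).
  by apply: ler_sum => t _; rewrite ler_wpM2l.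
by rewrite -mulr_suml p1 mul1r.
Qed.

Section Model.
Context (R : realType) (X Y Z J Xt : finType).
Context (PX : X -> R) (W : X * J -> Y * Z -> R) (d : X -> Xt -> R).
Hypothesis PX_dist : is_dist PX.
Hypothesis W_channel : is_channel W.
Hypothesis d_ge0 : forall x xt, 0 <= d x xt.

Notation source := (yz_source PX W).
Notation delta := (remote_distortion PX W d).

Lemma joint_ge0 Q x j y z : is_channel Q -> 0 <= joint PX W Q x j y z.
Proof.
move=> Qc; rewrite !mulr_ge0//; first by case: PX_dist.
  by case: (Qc x).
by case: (W_channel (x, j)).
Qed.

Lemma yz_source_ge0 Q y z : is_channel Q -> 0 <= source Q y z.
Proof.
by move=> Qc; apply: sumr_ge0 => x _; apply: sumr_ge0 => j _; exact: joint_ge0.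
Qed.

Lemma sum_channel2 x j : \sum_y \sum_z W (x, j) (y, z) = 1.
Proof. by rewrite -sum_pair; case: (W_channel (x, j)). Qed.

Lemma sum_yz_source Q : is_channel Q -> \sum_y \sum_z source Q y z = 1.
Proof.
move=> Qc; rewrite -exchange_sum2; case: PX_dist => _ <-.
apply: eq_bigr => x _; rewrite -[RHS]mulr1; case: (Qc x) => _ <-; rewrite mulr_sumr.
apply: eq_bigr => j _; rewrite /joint -[RHS]mulr1 -(sum_channel2 x j).
by rewrite mulr_sumr; apply: eq_bigr => y _; rewrite mulr_sumr.
Qed.

Lemma source_remote_distortion Q y z xt : is_channel Q ->
  source Q y z * delta Q y z xt = \sum_x \sum_j joint PX W Q x j y z * d x xt.
Proof.
move=> Qc; rewrite /remote_distortion.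
have [s0|s0] := eqVneq (source Q y z) 0; last by rewrite mulrC divfK.
rewrite s0 mul0r big1// => x _; rewrite big1// => j _.
suff -> : joint PX W Q x j y z = 0 by rewrite mul0r.
have j_ge0 x' : 0 <= \sum_j joint PX W Q x' j y z.
  by apply: sumr_ge0 => *; exact: joint_ge0.
move/eqP: s0; rewrite psumr_eq0// => /allP/(_ x); rewrite mem_index_enum => /(_ isT).
rewrite psumr_eq0 => [/allP/(_ j)|*]; last exact: joint_ge0.
by rewrite mem_index_enum => /(_ isT)/eqP.
Qed.

Lemma aux_infoE (U : finType) (PU : Y -> U -> R) Q :
  is_channel PU -> is_channel Q ->
  aux_info PX W PU Q = info (source Q) PU / ln 2.
Proof.
move=> PUc Qc; rewrite -cond_mutual_info_log2//; last by move=> *; exact: yz_source_ge0.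
congr cond_mutual_info; apply/funext => u; apply/funext => y; apply/funext => z.
by rewrite mulr_suml; apply: eq_bigr => x _; rewrite mulr_suml.
Qed.

Lemma aux_distortionE (U : finType) (PU : Y -> U -> R) (xt : U -> Z -> Xt) Q :
  is_channel Q ->
  aux_distortion PX W d PU xt Q = single_distortion (source Q) (delta Q) PU xt.
Proof.
move=> Qc; rewrite /aux_distortion exchange_sum2; apply: eq_bigr => y _.
apply: eq_bigr => z _.
rewrite pair_bigA/= exchange_big/=; apply: eq_bigr => u _.
rewrite mulrAC source_remote_distortion// -(pair_bigA _ (fun x j =>
  jointU PX W PU Q x j y z u * d x (xt u z))) mulr_suml; apply: eq_bigr => x _.
by rewrite mulr_suml; apply: eq_bigr => j _; rewrite mulrAC.
Qed.

Lemma word_remote_distortion Q n (y : word n Y) (z : word n Z) (xt : word n Xt) :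
  is_channel Q ->
  \sum_(x : word n X) \sum_(j : word n J)
    (\prod_k joint PX W Q (x k) (j k) (y k) (z k)) * \sum_i d (x i) (xt i) =
  word_source (source Q) y z * \sum_i delta Q (y i) (z i) (xt i).
Proof.
move=> Qc; rewrite mulr_sumr.
under eq_bigr do under eq_bigr do rewrite mulr_sumr.
under eq_bigr do rewrite exchange_big/=.
rewrite exchange_big/=; apply: eq_bigr => i _.
(* Putting the distortion on the [i]-th factor alone keeps a product over letters, so the sum over
   words becomes a product of single-letter sums. *)
pose F k x j := joint PX W Q x j (y k) (z k) * (if k == i then d x (xt i) else 1).
transitivity (\prod_k \sum_x \sum_j F k x j).
  rewrite -sum_prod_words; apply: eq_bigr => x _; apply: eq_bigr => j _.
  have -> : \prod_k F k (x k) (j k) = (\prod_k joint PX W Q (x k) (j k) (y k) (z k)) *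
      \prod_k (if k == i then d (x k) (xt i) else 1) by rewrite -big_split.
  by congr (_ * _); rewrite (bigD1 i)//= eqxx big1 ?mulr1// => k /negbTE ->.
rewrite /word_source (bigD1 i)//= [in RHS](bigD1 i)//= /F eqxx.
rewrite -source_remote_distortion// mulrAC; congr (_ * _ * _).
apply: eq_bigr => k /negbTE ->; apply: eq_bigr => x _.
by apply: eq_bigr => j _; rewrite mulr1.
Qed.

Definition code_kernel n M (c : Defs.code n M Y Z Xt) (y : word n Y) (m : 'I_M) : R :=
  (c.1 y == m)%:R.

Lemma code_kernel_channel n M (c : Defs.code n M Y Z Xt) : is_channel (code_kernel c).
Proof.
move=> y; split=> [m|]; first exact: ler0n.
by rewrite /code_kernel (bigD1 (c.1 y))//= eqxx big1 ?addr0// => m;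
  rewrite eq_sym => /negbTE ->.
Qed.

Lemma code_distortion_iid Q n M (C : Defs.code n M Y Z Xt -> R) : is_channel Q ->
  code_distortion PX W d C (@iid_adversary _ _ _ Q n) =
  \sum_c C c * (n%:R^-1 * word_cost (source Q) (delta Q) (code_kernel c)
                            (fun m z => c.2 (m, z))).
Proof.
move=> Qc; apply: eq_bigr => c _.
rewrite exchange_sum2 /word_cost !mulr_sumr; apply: eq_bigr => y _.
rewrite !mulr_sumr; apply: eq_bigr => z _.
have -> : \sum_v word_source (source Q) y z * code_kernel c y v *
      (\sum_i delta Q (y i) (z i) (c.2 (v, z) i)) =
    word_source (source Q) y z *
      (\sum_i delta Q (y i) (z i) (decoded c y z i)).
  rewrite (bigD1 (c.1 y))//= /code_kernel eqxx mulr1 [X in _ + X]big1 => [|m].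
    by rewrite addr0.
  by rewrite eq_sym => /negbTE ->; rewrite mulr0 mul0r.
rewrite -word_remote_distortion// !mulr_sumr; apply: eq_bigr => x _.
rewrite !mulr_sumr; apply: eq_bigr => j _.
by rewrite /joint !big_split/= /word_distortion /iid_adversary; ring.
Qed.

(** The expectations are nested in the order source, adversary, channel, code, so that [mean_le] can
    be applied to each in turn. *)
Lemma code_distortionE n M (C : Defs.code n M Y Z Xt -> R)
    (Q : word n X -> word n J -> R) :
  code_distortion PX W d C Q =
  \sum_(x : word n X) (\prod_i PX (x i)) * \sum_(j : word n J) Q x j *
    \sum_(y : word n Y) \sum_(z : word n Z) (\prod_i W (x i, j i) (y i, z i)) *
      \sum_c C c * word_distortion d x (decoded c y z).
Proof.
rewrite /code_distortion exchange_big/=; apply: eq_bigr => x _.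
rewrite mulr_sumr exchange_big/=; apply: eq_bigr => j _.
rewrite mulrA mulr_sumr exchange_big/=; apply: eq_bigr => y _.
rewrite mulr_sumr exchange_big/=; apply: eq_bigr => z _.
by rewrite !mulr_sumr; apply: eq_bigr => c _; ring.
Qed.

(** A sum instead of a maximum: any common bound on the distortions suffices. *)
Definition dmax : R := \sum_x \sum_xt d x xt.

Lemma dmax_ge0 : 0 <= dmax.
Proof. by apply: sumr_ge0 => x _; apply: sumr_ge0. Qed.

Lemma le_dmax x xt : d x xt <= dmax.
Proof.
rewrite /dmax (bigD1 x)//= (bigD1 xt)//= -addrA lerDl addr_ge0//.
  exact: sumr_ge0.
by apply: sumr_ge0 => *; exact: sumr_ge0.
Qed.

Lemma word_distortion_ge0 n (x : word n X) (xt : word n Xt) :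
  0 <= word_distortion d x xt.
Proof. by rewrite mulr_ge0 ?invr_ge0// sumr_ge0. Qed.

Lemma word_distortion_le n (x : word n X) (xt : word n Xt) :
  word_distortion d x xt <= dmax.
Proof.
case: n x xt => [|n] x xt; rewrite /word_distortion; first by rewrite invr0 mul0r dmax_ge0.
rewrite mulrC ler_pdivrMr ?ltr0n// mulr_natr -[n.+1 in leRHS]card_ord -sumr_const.
by apply: ler_sum => i _; exact: le_dmax.
Qed.

Lemma words_PX_dist n : is_dist (fun x : word n X => \prod_i PX (x i)).
Proof.
case: PX_dist => PX_ge0 PX1; split=> [x|]; first exact: prodr_ge0.
by rewrite -(bigA_distr_bigA (fun _ => PX)) big1.
Qed.

Lemma words_W_dist n (x : word n X) (j : word n J) :
  is_dist (fun p : word n Y * word n Z => \prod_i W (x i, j i) (p.1 i, p.2 i)).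
Proof.
split=> [p|]; first by apply: prodr_ge0 => i _; case: (W_channel (x i, j i)).
rewrite sum_pair (sum_prod_words (fun i y z => W (x i, j i) (y, z))) big1// => i _.
exact: sum_channel2.
Qed.

Lemma code_distortion_le n M (C : Defs.code n M Y Z Xt -> R)
    (Q : word n X -> word n J -> R) :
  is_dist C -> is_channel Q -> code_distortion PX W d C Q <= dmax.
Proof.
move=> Cd Qc; rewrite code_distortionE.
apply: mean_le => [|x]; first exact: words_PX_dist.
apply: mean_le => // j; rewrite (pair_bigA _ (fun y z => _ * _))/=.
apply: mean_le => [|p]; first exact: words_W_dist.
by apply: mean_le => // c; exact: word_distortion_le.
Qed.

Lemma code_distortion_le_max n M (C : Defs.code n M Y Z Xt -> R)
    (Q : word n X -> word n J -> R) :
  is_dist C -> is_channel Q ->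
  code_distortion PX W d C Q <= max_code_distortion PX W d C.
Proof.
move=> Cd Qc; apply: ub_le_sup; last by exists Q.
by exists dmax => _ [Q' Q'c <-]; exact: code_distortion_le.
Qed.

Hypothesis J_gt0 : (0 < #|J|)%N.

Lemma exists_adversary : exists Q : X -> J -> R, is_channel Q.
Proof.
have [j0 _] := card_gt0P J_gt0; exists (fun _ j => (j == j0)%:R) => x.
split=> [j|]; first exact: ler0n.
by rewrite (bigD1 j0)//= eqxx big1 ?addr0// => j /negbTE ->.
Qed.

Lemma dist_inhabited (T : finType) (p : T -> R) : is_dist p -> exists t : T, True.
Proof.
move=> [_ p1]; have [T0|/card_gt0P[t _]] := posnP #|T|; last by exists t.
have : (1 : R) = 0 => [|/eqP]; last by rewrite oner_eq0.
by rewrite -p1 big1// => t; have := card0_eq T0 t.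
Qed.

Lemma words_inhabited n : exists y : word n Y, True.
Proof.
have [x _] := dist_inhabited PX_dist; have [j _] := card_gt0P J_gt0.
have [[y _] _] := dist_inhabited (W_channel (x, j)).
by exists [ffun=> y].
Qed.

Lemma code_messages_gt0 n M (C : Defs.code n M Y Z Xt -> R) : is_dist C -> (0 < M)%N.
Proof.
move=> /dist_inhabited[c _]; have [y _] := words_inhabited n.
by case: (c.1 y) => m /(leq_ltn_trans (leq0n m)).
Qed.

Lemma num_messages_le n (r : R) :
  (0 < num_messages n r)%N -> ln (num_messages n r)%:R <= n%:R * (r * ln 2).
Proof.
move=> M0; rewrite mulrA -ln_powR ler_ln ?posrE ?ltr0n ?powR_gt0//.
by rewrite truncn_le ?powR_ge0.
Qed.

Lemma achievable_ge0 D r : achievable PX W d D r -> 0 <= r.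
Proof.
(* The length [n0.+1] is positive and can therefore be divided out. *)
move=> /(_ 1 ltr01)[n0 /(_ n0.+1 (leqnSn _))[C [Cd _]]].
have M0 := code_messages_gt0 Cd; rewrite -(pmulr_lge0 _ (x := ln 2)); last first.
  by rewrite ln_gt0// ltr1n.
rewrite -(pmulr_rge0 _ (x := n0.+1%:R)) ?ltr0n//.
by apply: le_trans (num_messages_le M0); rewrite ln_ge0// ler1n.
Qed.

(** A single length beyond [n0] suffices for each [eps], since [single_letterize] holds at every
    positive length. The kernel found depends on [Q], which is why the bound obtained is the max-min
    one. *)
Lemma converse D r Q : achievable PX W d D r -> is_channel Q ->
  exists K : Y -> {ffun Z -> Xt} -> R,
    [/\ is_channel K, aux_distortion PX W d K (fun f z => f z) Q <= D &
        aux_info PX W K Q <= r].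
Proof.
move=> ach Qc.
have s_ge0 y z : 0 <= source Q y z by exact: yz_source_ge0.
have [eps eps0|K [Kc KI KD]] := @limit_kernel R Y Z Xt (source Q) (delta Q)
    (r * ln 2) D s_ge0; last first.
  exists K; rewrite aux_distortionE// aux_infoE//; split=> //.
  by rewrite ler_pdivrMr// ln_gt0// ltr1n.
have [n0 /(_ n0.+1 (leqnSn _))[C [Cd CD]]] := ach _ eps0.
have M0 := code_messages_gt0 Cd.
have /mean_le_exists[//|c cD] :
    \sum_c C c * (n0.+1%:R^-1 * word_cost (source Q) (delta Q) (code_kernel c)
                            (fun m z => c.2 (m, z))) <= D + eps.
  rewrite -code_distortion_iid//; apply: le_trans CD.
  by apply: code_distortion_le_max => //; exact: iid_adversary_channel.
(* The encoder is a deterministic test channel from words to messages; its information is at most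
   the logarithm of the number of messages. *)
have [U [PU [xt [PUc UI UD]]]] := single_letterize (delta Q) (fun m z => c.2 (m, z))
  s_ge0 (sum_yz_source Qc) (code_kernel_channel c).
exists U, PU, xt; split=> //.
  rewrite -(@ler_pM2l _ n0.+1%:R) ?ltr0n//; apply: le_trans UI _.
  apply: le_trans (num_messages_le M0); rewrite -[X in ln X%:R]card_ord.
  apply: info_le_ln_card; [|exact: code_kernel_channel|].
    exact: word_source_ge0.
  by apply: sum_word_source; exact: sum_yz_source.
apply: le_trans cD; rewrite mulrC ler_pdivlMr ?ltr0n// mulrC.
exact: UD.
Qed.

End Model.

(** * Races between truncated geometric times *)

Definition geom_tail (R : realType) (h : R) (N k : nat) : R :=
  if (k <= N)%N then expR (- (h * k%:R)) else 0.

(* The geometric law of parameter [expR (- h)], with the mass beyond [N] put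
   on [N]. *)
Definition geom (R : realType) (h : R) (N : nat) (t : 'I_N.+1) : R :=
  geom_tail h N t - geom_tail h N t.+1.

Section Geometric.
Context (R : realType) (h : R) (N : nat).
Hypothesis h_gt0 : 0 < h.

Lemma geom_ge0 (t : 'I_N.+1) : 0 <= geom h t.
Proof.
rewrite subr_ge0 /geom_tail; case: ifPn => [tN|_]; last first.
  by rewrite -ltnS ltn_ord expR_ge0.
by rewrite -ltnS ltn_ord ler_expR lerN2 ler_pM2l// ler_nat.
Qed.

Lemma sum_geom_tail k : (k <= N)%N ->
  \sum_(t < N.+1 | (k <= t)%N) geom h t = expR (- (h * k%:R)).
Proof.
move=> kN; rewrite /geom -(big_mkord (fun t => (k <= t)%N)
  (fun t => geom_tail h N t - geom_tail h N t.+1)).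
rewrite (big_cat_nat _ (n := k))//=; last exact: leqW.
rewrite [X in X + _]big_nat_cond [X in X + _]big1 ?add0r; last first.
  by move=> i /andP[/andP[_ ik]]; rewrite leqNgt ik.
rewrite big_nat_cond (eq_bigl (fun t => (k <= t < N.+1)%N && true)); last first.
  by move=> i; case: (leqP k i); rewrite ?andbF ?andbT.
rewrite -big_nat_cond -[LHS]opprK -sumrN.
under eq_bigr do rewrite opprB.
by rewrite telescope_sumr ?(leqW kN)// opprB /geom_tail kN ltnn subr0.
Qed.

Lemma geom_dist : is_dist (@geom R h N).
Proof.
split; first exact: geom_ge0.
have := sum_geom_tail (leq0n N); rewrite mulr0 oppr0 expR0 => <-.
exact: eq_bigl.
Qed.

(** Times are counted from 1: the event [s < t.+1] contains [Num.truncn s <= t], whose probability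
    is an exact tail. *)
Lemma geom_survival (s : R) : 0 <= s -> s < N.+1%:R ->
  expR (- (h * s)) <= \sum_(t < N.+1) geom h t * (s < t.+1%:R)%R%:R.
Proof.
move=> s0 sN; have /andP[ks sk] := truncn_itv s0.
have kN : (Num.truncn s <= N)%N by rewrite -ltnS -(ltr_nat R); exact: le_lt_trans sN.
apply: (@le_trans _ _ (expR (- (h * (Num.truncn s)%:R)))).
  by rewrite ler_expR lerN2 ler_pM2l.
rewrite -sum_geom_tail// big_mkcond; apply: ler_sum => t _.
case: ifPn => [kt|_]; last by rewrite mulr_ge0 ?geom_ge0.
suff -> : s < t.+1%:R by rewrite mulr1.
by apply: lt_le_trans sk _; rewrite ler_nat.
Qed.

(** A discrete density bound, from [expR h - 1 >= h]. *)
Lemma geom_ge (t : 'I_N.+1) : (t < N)%N -> h * expR (- (h * t.+1%:R)) <= geom h t.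
Proof.
move=> tN; rewrite /geom /geom_tail (ltnW tN) tN.
have -> : expR (- (h * t%:R)) = expR (- (h * t.+1%:R)) * expR h.
  by rewrite -expRD; congr expR; rewrite -natr1; ring.
rewrite -[X in _ - X]mulr1 -mulrBr mulrC ler_pM2l ?expR_gt0//.
by rewrite lerBrDl expR_ge1Dx.
Qed.

End Geometric.

(** [r b] is the weight of [b] relative to that of [a]. The inequalities are strict, so a tie has no
    winner. *)
Definition beats (R : realType) (A : finType) (N : nat) (r : A -> R)
    (T : {ffun A -> 'I_N.+1}) (a : A) : bool :=
  [forall b, (b != a) ==> (r b * (T a).+1%:R < (T b).+1%:R)].

Lemma prob_beats (R : realType) (A : finType) (N : nat) (p : 'I_N.+1 -> R)
    (r : A -> R) (a : A) : is_dist p ->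
  \sum_(T : {ffun A -> 'I_N.+1}) (\prod_b p (T b)) * (beats r T a)%:R =
  \sum_t p t * \prod_(b | b != a) \sum_t' p t' * (r b * t.+1%:R < t'.+1%:R)%R%:R.
Proof.
move=> [p_ge0 p1].
(* The factor at [a] fixes [T a = t]; given that, the other coordinates are independent and the sum
   over [T] factorizes. *)
pose F t b t' := p t' * (if b == a then (t' == t)%:R
  else (r b * t.+1%:R < t'.+1%:R)%R%:R) : R.
transitivity (\sum_t \sum_(T : {ffun A -> 'I_N.+1}) \prod_b F t b (T b)).
  rewrite exchange_big/=; apply: eq_bigr => T _.
  have FE t : \prod_b F t b (T b) = (\prod_b p (T b)) * ((T a == t)%:R *
      \prod_(b | b != a) (r b * t.+1%:R < (T b).+1%:R)%R%:R).
    rewrite big_split/=; congr (_ * _); rewrite (bigD1 a)//= eqxx; congr (_ * _).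
    by apply: eq_bigr => b /negbTE ->.
  rewrite (eq_bigr _ (fun t _ => FE t)) -mulr_sumr; congr (_ * _).
  rewrite (bigD1 (T a))//= eqxx mul1r [X in _ + X]big1 ?addr0; last first.
    by move=> t; rewrite eq_sym => /negbTE ->; rewrite mul0r.
  rewrite /beats; case: forallP => [win|nwin].
    by rewrite big1// => b ba; move: (win b); rewrite ba => /= ->.
  have /existsP[b] : [exists b, ~~ ((b != a) ==> (r b * (T a).+1%:R < (T b).+1%:R))].
    by rewrite -negb_forall; apply/forallP.
  by rewrite negb_imply => /andP[ba /negbTE nb]; rewrite (bigD1 b)//= nb mul0r.
apply: eq_bigr => t _; rewrite -(bigA_distr_bigA (F t)) (bigD1 a)//=.
rewrite {1}/F eqxx (bigD1 t)//= eqxx mulr1 big1 ?addr0; last first.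
  by move=> t' /negbTE ->; rewrite mulr0.
by congr (_ * _); apply: eq_bigr => b /negbTE ba; rewrite /F ba.
Qed.

(* For independent exponential times the winning probability is exactly
   [(1 + sum r)^-1]; [h -> 0], [N -> oo] is the discretization. *)
Lemma exists_race (R : realType) (A : finType) (eta rmax : R) :
  0 < eta -> 0 <= rmax ->
  exists (N : nat) (p : 'I_N.+1 -> R), is_dist p /\
    forall (r : A -> R) (a : A), (forall b, 0 <= r b <= rmax) ->
    (1 - eta) / (1 + \sum_(b | b != a) r b) <=
    \sum_(T : {ffun A -> 'I_N.+1}) (\prod_b p (T b)) * (beats r T a)%:R.
Proof.
move=> eta0 rmax0; pose Smax := #|A|%:R * rmax.
have Smax0 : 0 <= Smax by rewrite mulr_ge0.
(* [h] makes [h * (1 + S) <= eta / 2], hence [x >= 1 - eta / 2]; [tau] makes [x ^+ tau <= eta / 2];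
   and [N] is so large that every [r b * t.+1] with [t < tau] stays below the cutoff. *)
pose h := eta / (2 * (1 + Smax)).
have h0 : 0 < h by rewrite divr_gt0// mulr_gt0// ltr_wpDr.
pose tau := (Num.truncn (2 / (eta * h))).+1.
pose N := (tau * (Num.truncn rmax).+1)%N.
have tauN : (tau <= N)%N by rewrite leq_pmulr.
exists N, (@geom R h N); split=> [|r a r_bnd]; first exact: geom_dist.
have r0 b : 0 <= r b by case/andP: (r_bnd b).
set S := \sum_(b | _) _.
have S0 : 0 <= S by apply: sumr_ge0.
have SS : S <= Smax.
  rewrite /Smax /S mulr_natl -sumr_const [leLHS]big_mkcond; apply: ler_sum => b _.
  by case: ifP => // _; case/andP: (r_bnd b).
rewrite (prob_beats _ _ (geom_dist _ h0)).
pose x := expR (- (h * (1 + S))).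
have x0 : 0 < x := expR_gt0 _.
have hS : 0 < h * (1 + S) by rewrite mulr_gt0// ltr_wpDr.
have x1 : x < 1 by rewrite expR_lt1 oppr_lt0.
(* Only the times [t < tau] are kept. There the density bound times the survival bounds is
   [h * x ^+ t.+1], which leaves a geometric sum. *)
apply: (@le_trans _ _ (\sum_(t < N.+1 | (t < tau)%N) h * (x * x ^+ t))); last first.
  rewrite big_mkcond; apply: ler_sum => t _; case: ifPn => [tt|_]; last first.
    by rewrite mulr_ge0 ?geom_ge0// prodr_ge0// => b _; apply: sumr_ge0 => t' _;
       rewrite mulr_ge0 ?geom_ge0.
  have -> : h * (x * x ^+ t) = h * expR (- (h * t.+1%:R)) *
      \prod_(b | b != a) expR (- (h * (r b * t.+1%:R))).
    rewrite -expR_sum -mulrA -expRD -exprS -expRM_natl; congr (_ * expR _).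
    by rewrite sumrN -mulr_sumr -mulr_suml -/S; ring.
  apply: ler_pM.
  - exact: mulr_ge0 (ltW h0) (expR_ge0 _).
  - by apply: prodr_ge0 => *; exact: expR_ge0.
  - by apply: geom_ge => //; exact: leq_trans tauN.
  apply: ler_prod => b _; rewrite expR_ge0/=; apply: geom_survival => //.
    by rewrite mulr_ge0.
  apply: (@le_lt_trans _ _ (rmax * tau%:R)).
    by rewrite ler_pM// ?ler_nat//; case/andP: (r_bnd b).
  rewrite -natr1 /N natrM mulrC; apply: ltr_wpDr => //.
  by rewrite ltr_pM2l ?ltr0n// truncnS_gt.
have -> : \sum_(t < N.+1 | (t < tau)%N) h * (x * x ^+ t) =
    h * x * \sum_(t < tau) x ^+ t.
  rewrite mulr_sumr (big_ord_widen_cond N.+1 xpredT (fun t => h * x * x ^+ t));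
    last exact: leqW.
  by apply: eq_bigr => t _; rewrite mulrA.
have -> : \sum_(t < tau) x ^+ t = (1 - x ^+ tau) / (1 - x).
  rewrite -[in RHS](opprK (1 - x ^+ tau)) opprB subrX1 -mulNr opprB mulrAC.
  by rewrite mulfV ?mul1r// subr_eq0 gt_eqF.
have xle : 1 - x <= h * (1 + S).
  by have := expR_ge1Dx (- (h * (1 + S))); rewrite -/x; lra.
have xge : 1 - eta / 2 <= x.
  have : h * (1 + S) <= eta / 2; last by move: xle; lra.
  rewrite /h mulrAC ler_pdivrMr ?mulr_gt0 ?ltr_wpDr//.
  have : eta * S <= eta * Smax by rewrite ler_pM2l.
  by move: eta0; nra.
have xtau : x ^+ tau <= eta / 2.
  rewrite -expRM_natl mulrN.
  have tau_ge : 2 / eta <= tau%:R * (h * (1 + S)).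
    have : 2 / (eta * h) <= tau%:R by rewrite ltW// truncnS_gt.
    rewrite (ler_pdivrMr _ _ (mulr_gt0 eta0 h0)) (ler_pdivrMr _ _ eta0) => le2.
    have := mulr_ge0 (mulr_ge0 (mulr_ge0 (ler0n R tau) (ltW h0)) S0) (ltW eta0).
    by move: le2; lra.
  rewrite expRN -[leRHS]invrK lef_pV2 ?posrE ?expR_gt0 ?invr_gt0 ?divr_gt0//.
  rewrite invf_div; apply: le_trans tau_ge (le_trans _ (expR_ge1Dx _)).
  by rewrite lerDr.
have xtau0 : 0 <= x ^+ tau by rewrite exprn_ge0// ltW.
have S1 : 0 < 1 + S by rewrite ltr_wpDr.
(* The first factor is at least [(1 - eta / 2) ^ 2 >= 1 - eta] when [eta < 1], and the remaining
   [h / (1 - x)] is at least [1 / (1 + S)] because [1 - x <= h * (1 + S)]. *)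
apply: (@le_trans _ _ (x * (1 - x ^+ tau) / (1 + S))).
  rewrite ler_pM2r ?invr_gt0//.
  have xtau1 : x ^+ tau <= 1 by rewrite exprn_ile1 ?ltW.
  have [e2|e2] := leP 1 eta.
    by apply: (@le_trans _ _ 0); [rewrite subr_le0|rewrite (mulr_ge0 (ltW x0))// subr_ge0].
  apply: (@le_trans _ _ ((1 - eta / 2) * (1 - eta / 2))); first by nra.
  by apply: ler_pM => //; lra.
have -> : h * x * ((1 - x ^+ tau) / (1 - x)) = x * (1 - x ^+ tau) * (h / (1 - x)).
  by ring.
have c0 : 0 <= x * (1 - x ^+ tau).
  by rewrite (mulr_ge0 (ltW x0))// subr_ge0 exprn_ile1 ?ltW.
rewrite (ler_wpM2l c0)//.
by rewrite ler_pdivlMr ?subr_gt0// mulrC ler_pdivrMr.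
Qed.

(** * One-shot coding with side information *)

Lemma le_term_sum (R : realType) (T : finType) (F : T -> R) :
  (forall t, 0 <= F t) -> forall t, F t <= \sum_t F t.
Proof. by move=> F0 t; rewrite (bigD1 t)//= lerDl sumr_ge0. Qed.

(** [rho / (1 + rho)] is at most the minimum of 1 and [rho], hence at most [rho ^ lam]. A power is
    wanted because it factorizes over the letters of a word. *)
Lemma inv1D_ge (R : realType) (rho lam : R) :
  0 <= rho -> 0 <= lam <= 1 -> 1 - rho `^ lam <= (1 + rho)^-1.
Proof.
move=> rho0 /andP[lam0 lam1]; have rho1 : 0 < 1 + rho by rewrite ltr_wpDr.
have p0 := powR_ge0 rho lam.
suff : rho / (1 + rho) <= rho `^ lam.
  have -> : rho / (1 + rho) = 1 - (1 + rho)^-1 by field; rewrite gt_eqF.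
  by lra.
have [r1|r1] := leP rho 1.
  apply: (@le_trans _ _ rho); first by rewrite ler_pdivrMr// ler_peMr// lerDl.
  have [->|r0] := eqVneq rho 0; first by rewrite powR_ge0.
  by apply: ger1_powR; rewrite // lt_neqAle eq_sym r0 rho0.
apply: (@le_trans _ _ 1); first by rewrite ler_pdivrMr// mul1r lerDr.
by rewrite -(powRr0 rho) ler_powR// ltW.
Qed.

(** [a] is the strict minimizer of time over weight, cross-multiplied to avoid dividing by a zero
    weight. *)
Definition wins (R : realType) (A : finType) (N : nat) (P : A -> R)
    (T : {ffun A -> 'I_N.+1}) (a : A) : bool :=
  [forall b, (b != a) ==> (P b * (T a).+1%:R < P a * (T b).+1%:R)].

Lemma wins_unique (R : realType) (A : finType) (N : nat) (P : A -> R)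
    (T : {ffun A -> 'I_N.+1}) (a b : A) :
  wins P T a -> wins P T b -> a = b.
Proof.
move=> /forallP Pa /forallP Pb; apply/eqP/negPn/negP => ab.
move: (Pa b) (Pb a); rewrite ab eq_sym ab/= => h1 /(lt_trans h1).
by rewrite ltxx.
Qed.

Lemma pick_wins (R : realType) (A : finType) (N : nat) (P : A -> R)
    (T : {ffun A -> 'I_N.+1}) (a0 a : A) :
  wins P T a -> odflt a0 [pick b | wins P T b] = a.
Proof.
move=> Pa; case: pickP => [b Pb|/(_ a)]; first exact: wins_unique Pb Pa.
by rewrite Pa.
Qed.

Lemma sum_ffun_prod_dist (R : realType) (A B : finType) (p : B -> R) :
  is_dist p -> is_dist (fun T : {ffun A -> B} => \prod_a p (T a)).
Proof.
move=> [p_ge0 p1]; split=> [T|]; first exact: prodr_ge0.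
by rewrite -(bigA_distr_bigA (fun _ => p)) big1.
Qed.

(* The encoder draws [(u, m)] from [P(u|y)/M] by the race and sends [m]; the
   decoder runs the same race, restricted to [m], with weights [q(u|z)]. They
   agree with conditional probability at least about
   [(1 + P(u|y) / (M q(u|z)))^-1]. *)
Lemma one_shot_coding (R : realType) (Yn Zn Un : finType) (M : nat)
    (P : Yn -> Un -> R) (q : Zn -> Un -> R) (u0 : Un) (lam eta B : R) :
  (0 < M)%N -> is_channel P -> (forall z u, 0 < q z u) ->
  (forall z, \sum_u q z u <= 1) -> 0 <= lam <= 1 -> 0 < eta < 1 ->
  exists (Omega : finType) (w : Omega -> R) (enc : Omega -> Yn -> 'I_M)
    (dec : Omega -> 'I_M -> Zn -> Un), is_dist w /\
    forall y z (cost : Un -> R), (forall u, 0 <= cost u <= B) ->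
    \sum_o w o * cost (dec o (enc o y) z) <=
    \sum_u P y u * cost u +
      B * \sum_u P y u * (P y u / (M%:R * q z u)) `^ lam + eta * B.
Proof.
move=> M0 Pc q0 q1 lam01 /andP[eta0 eta1].
have P_ge0 y u : 0 <= P y u by case: (Pc y).
have M0' : 0 < M%:R :> R by rewrite ltr0n.
pose Pa y (a : Un * 'I_M) : R := P y a.1 / M%:R.
have Pa_ge0 y a : 0 <= Pa y a by rewrite divr_ge0.
have sumPa y : \sum_a Pa y a = 1.
  rewrite sum_pair; case: (Pc y) => _ <-; apply: eq_bigr => u _.
  by rewrite /Pa/= sumr_const card_ord -[LHS]mulr_natr divfK// gt_eqF.
(* The relative weight adds the ratio of the encoder's race to that of the decoder's race, the
   latter restricted to the message of [a]; beating it wins both races at once. *)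
pose r y z (a b : Un * 'I_M) : R :=
  Pa y b / Pa y a + (b.2 == a.2)%:R * (q z b.1 / q z a.1).
have r_ge0 y z a b : 0 <= r y z a b.
  by rewrite addr_ge0 ?divr_ge0// mulr_ge0// divr_ge0// ltW.
pose r' (p : Yn * Zn * (Un * 'I_M) * (Un * 'I_M)) := r p.1.1.1 p.1.1.2 p.1.2 p.2.
have r'_ge0 p : 0 <= r' p by exact: r_ge0.
pose rmax := \sum_p r' p.
have r_le y z a b : r y z a b <= rmax by exact: (le_term_sum r'_ge0 (y, z, a, b)).
have rmax0 : 0 <= rmax by exact: sumr_ge0.
have [N [p [p_dist race]]] := exists_race (Un * 'I_M)%type eta0 rmax0.
pose a0 : Un * 'I_M := (u0, Ordinal M0).
pose Omega : finType := {ffun Un * 'I_M -> 'I_N.+1}.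
pose enc (T : Omega) y := (odflt a0 [pick a | wins (Pa y) T a]).2.
pose dec' (T : Omega) m z := odflt u0 [pick u | wins (q z) [ffun u => T (u, m)] u].
exists Omega, (fun T : Omega => \prod_a p (T a)), enc, dec'.
have wd := sum_ffun_prod_dist (Un * 'I_M)%type p_dist.
split=> // y z cost cost_bnd; pose w (T : Omega) := \prod_a p (T a).
have {wd} [w_ge0 w1] : is_dist w by [].
pose dec (T : Omega) := dec' T (enc T y) z.
rewrite -[leLHS]/(\sum_(T : Omega) w T * cost (dec T)).
(* The complement of the cost is nonnegative, so its expectation may be bounded below by keeping
   only the events where both ends agree. *)
pose gain u := B - cost u.
have gain0 u : 0 <= gain u by rewrite subr_ge0; case/andP: (cost_bnd u).
have gainB u : gain u <= B by rewrite gerBl; case/andP: (cost_bnd u).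
pose good a (T : {ffun Un * 'I_M -> 'I_N.+1}) := (0 < P y a.1) && beats (r y z a) T a.
have good_enc a T : good a T -> wins (Pa y) T a.
  move=> /andP[Pya /forallP win]; apply/forallP => b; apply/implyP => ba.
  move: (win b); rewrite ba/= => rb.
  have Pa0 : 0 < Pa y a by rewrite divr_gt0.
  have : Pa y b / Pa y a * (T a).+1%:R < (T b).+1%:R.
    by apply: le_lt_trans rb; rewrite ler_wpM2r// lerDl mulr_ge0// divr_ge0// ltW.
  by rewrite mulrAC ltr_pdivrMr// mulrC [ltRHS]mulrC mulrC.
have good_dec a T : good a T -> wins (q z) [ffun u => T (u, a.2)] a.1.
  move=> /andP[Pya /forallP win]; apply/forallP => u; apply/implyP => ua.
  have ba : (u, a.2) != a by case: a ua {win Pya} => a1 a2 /=; apply: contra => /eqP[->].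
  move: (win (u, a.2)); rewrite ba/= => rb; rewrite !ffunE -surjective_pairing.
  have : q z u / q z a.1 * (T a).+1%:R < (T (u, a.2)).+1%:R.
    apply: le_lt_trans rb; rewrite ler_wpM2r// /r eqxx mul1r lerDr divr_ge0//.
  by rewrite mulrAC ltr_pdivrMr// [ltRHS]mulrC.
have decE a T : good a T -> dec T = a.1.
  move=> g; rewrite /dec /enc (pick_wins _ (good_enc _ _ g)).
  exact: (pick_wins _ (good_dec _ _ g)).
(* At most one [a] is good, by [wins_unique], and the decoder then outputs [a.1]. *)
have gain_ge T : \sum_a (good a T)%:R * gain a.1 <= gain (dec T).
  case: (pickP (fun a => good a T)) => [a ga|ng]; last first.
    by rewrite big1// => a _; rewrite ng mul0r.
  rewrite (bigD1 a)//= ga mul1r -(decE _ _ ga) big1 ?addr0// => b ba.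
  case gb: (good b T); last by rewrite mul0r.
  by move: ba; rewrite (wins_unique (good_enc _ _ gb) (good_enc _ _ ga)) eqxx.
pose rho u := P y u / (M%:R * q z u).
have rho_ge0 u : 0 <= rho u by rewrite divr_ge0// mulr_ge0// ltW.
pose c := \sum_u P y u * (gain u * (1 - rho u `^ lam)).
have Egain : (1 - eta) * c <= \sum_(T : Omega) w T * gain (dec T).
  apply: (@le_trans _ _ (\sum_(T : Omega) w T * \sum_a (good a T)%:R * gain a.1));
    last by apply: ler_sum => T _; rewrite ler_wpM2l.
  under [leRHS]eq_bigr do rewrite mulr_sumr.
  rewrite exchange_big/=.
  have -> : (1 - eta) * c =
      \sum_(a : Un * 'I_M) (1 - eta) * (Pa y a * (gain a.1 * (1 - rho a.1 `^ lam))).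
    rewrite -mulr_sumr sum_pair; congr (_ * _); apply: eq_bigr => u _.
    rewrite /Pa/= sumr_const card_ord -[RHS]mulr_natr; field.
    by rewrite gt_eqF.
  apply: ler_sum => a _.
  have -> : \sum_(T : Omega) w T * ((good a T)%:R * gain a.1) =
      gain a.1 * \sum_(T : Omega) w T * (good a T)%:R.
    by rewrite mulr_sumr; apply: eq_bigr => T _; rewrite mulrA mulrC.
  have [Pya|] := ltP 0 (P y a.1); last first.
    rewrite le_eqVlt ltNge P_ge0 orbF => /eqP Pya.
    by rewrite /Pa Pya mul0r mul0r mulr0 mulr_ge0// sumr_ge0// => T _; rewrite mulr_ge0.
  have Pa0 : 0 < Pa y a by rewrite divr_gt0.
  have -> : (1 - eta) * (Pa y a * (gain a.1 * (1 - rho a.1 `^ lam))) =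
      gain a.1 * ((1 - eta) * (Pa y a * (1 - rho a.1 `^ lam))) by ring.
  rewrite ler_wpM2l//.
  have -> : \sum_(T : Omega) w T * (good a T)%:R =
      \sum_(T : Omega) w T * (beats (r y z a) T a)%:R.
    by apply: eq_bigr => T _; rewrite /good Pya.
  apply: le_trans (race (r y z a) a _); last by move=> b; rewrite r_ge0 r_le.
  rewrite ler_pM2l ?subr_gt0//.
  have S_ge0 : 0 <= \sum_(b | b != a) r y z a b by apply: sumr_ge0.
  apply: (@le_trans _ _ (Pa y a * (1 + rho a.1)^-1)).
    by rewrite ler_pM2l// inv1D_ge.
  have rho1 : 0 < 1 + rho a.1 by rewrite ltr_wpDr.
  rewrite -[X in X <= _]invrK lef_pV2 ?posrE ?invr_gt0 ?ltr_wpDr//; last first.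
    by rewrite mulr_gt0// invr_gt0.
  (* The two parts of the sum of [r] are [1 / Pa - 1] and at most [1 / q - 1], while
     [(1 + rho) / Pa] equals [1 / Pa + 1 / q]. *)
  rewrite invfM invrK big_split/=.
  have -> : \sum_(b | b != a) Pa y b / Pa y a = (Pa y a)^-1 - 1.
    rewrite -mulr_suml; have := sumPa y; rewrite (bigD1 a)//= => /(canRL (addKr _)) ->.
    by rewrite mulrDl mulNr mulfV ?gt_eqF// mul1r addrC.
  have qa0 := q0 z a.1.
  have : \sum_(b | b != a) (b.2 == a.2)%:R * (q z b.1 / q z a.1) <= (q z a.1)^-1 - 1.
    have -> : \sum_(b | b != a) (b.2 == a.2)%:R * (q z b.1 / q z a.1) =
        \sum_(u | u != a.1) q z u / q z a.1.
      transitivity (\sum_(b : Un * 'I_M) (b != a)%:R * ((b.2 == a.2)%:R * (q z b.1 / q z a.1))).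
        by rewrite big_mkcond; apply: eq_bigr => b _; case: (b != a); rewrite ?mul1r ?mul0r.
      rewrite sum_pair [RHS]big_mkcond; apply: eq_bigr => u _.
      rewrite (bigD1 a.2)//= eqxx mul1r big1 ?addr0 => [|m /negbTE ->]; last first.
        by rewrite mul0r mulr0.
      have -> : ((u, a.2) != a) = (u != a.1).
        by rewrite -pair_eqE/= eqxx andbT.
      by case: (u != a.1); rewrite ?mul1r ?mul0r.
    rewrite -mulr_suml ler_pdivrMr// mulrBl mulVf ?gt_eqF// mul1r.
    by rewrite lerBrDl; have := q1 z; rewrite (bigD1 a.1).
  have -> : (Pa y a)^-1 * (1 + rho a.1) = (Pa y a)^-1 + (q z a.1)^-1.
    by rewrite /rho /Pa; field; rewrite !gt_eqF.
  by lra.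
have sumP : \sum_u P y u = 1 by case: (Pc y).
have cB : c <= B.
  apply: mean_le => // u; apply: le_trans (gainB u).
  by rewrite ler_piMr// gerBl powR_ge0.
have -> : \sum_(T : Omega) w T * cost (dec T) =
    B - \sum_(T : Omega) w T * gain (dec T).
  rewrite /gain; under [in RHS]eq_bigr do rewrite mulrBr.
  by rewrite sumrB -mulr_suml w1 mul1r opprB addrC subrK.
have -> : \sum_u P y u * cost u = B - \sum_u P y u * gain u.
  rewrite /gain; under [in RHS]eq_bigr do rewrite mulrBr.
  by rewrite sumrB -mulr_suml sumP mul1r opprB addrC subrK.
have cE : c = \sum_u P y u * gain u - \sum_u P y u * (gain u * rho u `^ lam).
  by rewrite -sumrB; apply: eq_bigr => u _; ring.
have Erho : \sum_u P y u * (gain u * rho u `^ lam) <= B * \sum_u P y u * rho u `^ lam.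
  rewrite mulr_sumr; apply: ler_sum => u _; rewrite [leRHS]mulrCA ler_wpM2l//.
  by rewrite ler_wpM2r ?powR_ge0.
have : eta * c <= eta * B by rewrite ler_pM2l.
by move: Egain Erho; rewrite cE; lra.
Qed.

(** * A decoder for all adversaries *)

Definition mix (R : realType) (X J : finType) (t : R) (Q Q' : X -> J -> R)
    (x : X) (j : J) : R :=
  (1 - t) * Q x j + t * Q' x j.

Lemma mix_channel (R : realType) (X J : finType) (t : R) (Q Q' : X -> J -> R) :
  0 <= t <= 1 -> is_channel Q -> is_channel Q' -> is_channel (mix t Q Q').
Proof.
move=> /andP[t0 t1] Qc Qc' x; case: (Qc x) (Qc' x) => Q0 Q1 [Q'0 Q'1]; split=> [j|].
  by rewrite addr_ge0// mulr_ge0// subr_ge0.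
by rewrite big_split/= -!mulr_sumr Q1 Q'1; ring.
Qed.

Lemma channel_le1 (R : realType) (A B : finType) (K : A -> B -> R) a b :
  is_channel K -> K a b <= 1.
Proof.
by move=> Kc; case: (Kc a) => K0 <-; exact: (le_term_sum K0).
Qed.

(** Replacing [q] by a [q'] that is smaller by a factor of at most [expR c] costs at most [c], as
    [s] and [K] have total mass 1. *)
Lemma log_loss_le (R : realType) (A B V : finType) (s : A -> B -> R)
    (K : A -> V -> R) (q q' : B -> V -> R) (c : R) :
  (forall a b, 0 <= s a b) -> is_channel K -> \sum_a \sum_b s a b = 1 ->
  (forall a b v, 0 < s a b * K a v ->
    [/\ 0 < q b v, 0 < q' b v & q b v <= expR c * q' b v]) ->
  log_loss s K q' <= log_loss s K q + c.
Proof.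
move=> s_ge0 Kc s1 qq'.
have -> : c = \sum_a \sum_b \sum_v s a b * K a v * c.
  rewrite -[LHS]mul1r -[in LHS]s1 mulr_suml; apply: eq_bigr => a _.
  rewrite mulr_suml; apply: eq_bigr => b _.
  by rewrite -mulr_suml -mulr_sumr; case: (Kc a) => _ ->; rewrite mulr1.
rewrite -big_split; apply: ler_sum => a _; rewrite -big_split.
apply: ler_sum => b _; rewrite -big_split; apply: ler_sum => v _ /=.
have [sK0|] := ltP 0 (s a b * K a v); last first.
  have K0 : 0 <= K a v by case: (Kc a).
  by rewrite le_eqVlt ltNge mulr_ge0// orbF => /eqP ->; rewrite !mul0r addr0.
have [q0 q'0 qle] := qq' _ _ _ sK0; have [_ K0] := mul_gt0_factors s_ge0 Kc sK0.
rewrite -mulrDr ler_pM2l// !ln_div ?posrE// -addrA lerD2l addrC lerBrDr addrC lerBlDr.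
have : ln (q b v) <= ln (expR c * q' b v).
  by rewrite ler_ln// posrE mulr_gt0// expR_gt0.
by rewrite lnM ?posrE ?expR_gt0// expRK.
Qed.

Section Minimax.
Context (R : realType) (X Y Z J U : finType).
Context (PX : X -> R) (W : X * J -> Y * Z -> R) (PU : Y -> U -> R).
Hypothesis PX_dist : is_dist PX.
Hypothesis W_channel : is_channel W.
Hypothesis PU_channel : is_channel PU.
Hypothesis J_gt0 : (0 < #|J|)%N.

Notation source := (yz_source PX W).

Lemma yz_source_mix t Q Q' y z :
  source (mix t Q Q') y z = (1 - t) * source Q y z + t * source Q' y z.
Proof.
rewrite /yz_source !mulr_sumr -big_split; apply: eq_bigr => x _ /=.
rewrite !mulr_sumr -big_split; apply: eq_bigr => j _ /=.
by rewrite /joint /mix; ring.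
Qed.

Lemma log_loss_mix t Q Q' (q : Z -> U -> R) :
  log_loss (source (mix t Q Q')) PU q =
  (1 - t) * log_loss (source Q) PU q + t * log_loss (source Q') PU q.
Proof.
rewrite /log_loss !mulr_sumr -big_split; apply: eq_bigr => y _ /=.
rewrite !mulr_sumr -big_split; apply: eq_bigr => z _ /=.
rewrite !mulr_sumr -big_split; apply: eq_bigr => u _ /=.
by rewrite yz_source_mix; ring.
Qed.

Lemma yz_source_le (c : R) Q Q' y z : (forall x j, Q x j <= c * Q' x j) ->
  source Q y z <= c * source Q' y z.
Proof.
move=> QQ'; rewrite /yz_source mulr_sumr; apply: ler_sum => x _.
rewrite mulr_sumr; apply: ler_sum => j _; rewrite /joint.
have -> : c * (PX x * Q' x j * W (x, j) (y, z)) =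
  PX x * (c * Q' x j) * W (x, j) (y, z) by ring.
case: (W_channel (x, j)) => W0 _; rewrite ler_wpM2r// ler_wpM2l//.
by case: PX_dist.
Qed.

Definition uniform_adversary (x : X) (j : J) : R := #|J|%:R^-1.

Lemma uniform_adversary_channel : is_channel uniform_adversary.
Proof.
move=> x; split=> [j|]; first by rewrite invr_ge0.
rewrite sumr_const -[LHS]mulr_natr mulVf// pnatr_eq0 -lt0n.
exact: J_gt0.
Qed.

(* An approximate maximizer [Q0] of the information over the strategies
   [mix th Q uniform] has a posterior which is nearly optimal against every such
   strategy, because the information, being concave, cannot increase much from
   [Q0] towards another strategy; [th > 0] keeps the posterior bounded away
   from 0. *)
Lemma minimax (v eps : R) :
  (forall Q, is_channel Q -> info (source Q) PU <= v) -> 0 < eps ->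
  exists q : Z -> U -> R, [/\ forall z u, 0 < q z u,
    forall z, \sum_u q z u <= 1 &
    forall Q, is_channel Q -> log_loss (source Q) PU q <= v + eps].
Proof.
move=> v_max eps0.
(* The four quarters pay for near-optimality of [Q0], for replacing the posterior of the mixture by
   that of [Q0], for removing the uniform part, and for making [q] positive. *)
pose e := eps / 4; have e0 : 0 < e by rewrite divr_gt0.
have s_ge0 Q : is_channel Q -> forall y z, 0 <= source Q y z.
  by move=> Qc y z; exact: yz_source_ge0.
have uc := uniform_adversary_channel.
have v0 : 0 <= v.
  by apply: le_trans (v_max _ uc); apply: info_ge0 => //; exact: s_ge0.
(* Chosen so that [(1 - th) * (v + 3 * e) = v + 2 * e]. *)
pose th := e / (v + 3 * e).
have ve0 : 0 < v + 3 * e by rewrite ltr_wpDl// mulr_gt0.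
have th0 : 0 < th by rewrite divr_gt0.
have th1 : th < 1 by rewrite ltr_pdivrMr//; lra.
have th01 : 0 <= th <= 1 by rewrite !ltW.
pose Qth Q := mix th Q uniform_adversary.
have Qthc Q : is_channel Q -> is_channel (Qth Q).
  by move=> Qc; exact: mix_channel.
pose c0 := #|J|%:R / th.
have J0 : 0 < #|J|%:R :> R by rewrite ltr0n.
have c00 : 0 < c0 by rewrite divr_gt0.
(* Small enough for [1 + t * c0 <= (1 + e) * (1 - t)], which keeps the posterior of the mixture
   within a factor [expR e] of that of [Q0]. *)
pose t := e / (2 * (1 + c0) + 2 * e).
have t0 : 0 < t by rewrite divr_gt0// addr_gt0// mulr_gt0// addr_gt0.
have tE : t * (2 * (1 + c0) + 2 * e) = e.
  by rewrite divfK// gt_eqF// addr_gt0// mulr_gt0// addr_gt0.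
have t2 : t <= 1 / 2.
  have : 0 <= t * (1 + c0) by rewrite mulr_ge0 ?ltW// addr_gt0.
  by move=> tc; rewrite -(ler_pM2r e0); move: tE tc; lra.
have t1 : t < 1 by lra.
have t01 : 0 <= t <= 1 by rewrite !ltW.
pose V := [set info (source (Qth Q)) PU | Q in [set Q | is_channel Q]].
have V_sup : has_sup V.
  split; first by exists (info (source (Qth uniform_adversary)) PU); exists uniform_adversary.
  by exists v => _ [Q Qc <-]; apply: v_max; exact: Qthc.
(* The gap to the supremum is [t * e], because a step of size [t] away from [Q0] will be divided by
   [t]. *)
have [_ [Q0 Q0c <-] Q0max] := sup_adherent (mulr_gt0 t0 e0) V_sup.
set s0 := source (Qth Q0) in Q0max.
have s0_ge0 y z : 0 <= s0 y z by exact: (s_ge0 _ (Qthc _ Q0c)).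
pose q := posterior s0 PU.
have Qle Q x j : is_channel Q -> Qth Q x j <= c0 * Qth Q0 x j.
  move=> Qc; apply: (@le_trans _ _ 1); first by apply: channel_le1; exact: Qthc.
  have Q0x : 0 <= Q0 x j by case: (Q0c x).
  rewrite /Qth /mix /c0 /uniform_adversary mulrDr.
  have -> : #|J|%:R / th * (th / #|J|%:R) = 1 :> R by field; rewrite !gt_eqF.
  by rewrite lerDr (mulr_ge0 (ltW c00))// mulr_ge0// subr_ge0 ltW.
have sle Q y z : is_channel Q -> source (Qth Q) y z <= c0 * s0 y z.
  by move=> Qc; apply: yz_source_le => x j; exact: Qle.
have s0_gt0 Q y z : is_channel Q -> 0 < source (Qth Q) y z -> 0 < s0 y z.
  by move=> Qc s1; rewrite -(pmulr_rgt0 _ c00); apply: lt_le_trans s1 (sle _ _ _ Qc).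
have q_gt0 Q y z u : is_channel Q -> 0 < source (Qth Q) y z * PU y u -> 0 < q z u.
  move=> Qc sPU.
  have [s1 PU0] := mul_gt0_factors (s_ge0 _ (Qthc _ Qc)) PU_channel sPU.
  by apply: (@posterior_gt0 _ _ _ _ s0 PU _ _ y) => //; rewrite mulr_gt0// (s0_gt0 Q).
have near_opt Q : is_channel Q -> log_loss (source (Qth Q)) PU q <= v + 2 * e.
  move=> Qc; set s1 := source (Qth Q).
  have s1_ge0 := s_ge0 _ (Qthc _ Qc).
  pose st := source (mix t (Qth Q0) (Qth Q)).
  have stE y z : st y z = (1 - t) * s0 y z + t * s1 y z by exact: yz_source_mix.
  have stc : is_channel (mix t (Qth Q0) (Qth Q)).
    by apply: mix_channel => //; exact: Qthc.
  have st_ge0 := s_ge0 _ stc.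
  have st_ge y z : (1 - t) * s0 y z <= st y z by rewrite stE lerDl mulr_ge0// ltW.
  pose qt := posterior st PU.
  have qt_gt0 y z u : 0 < s0 y z * PU y u -> 0 < qt z u.
    move=> sPU; have [s00 PU0] := mul_gt0_factors s0_ge0 PU_channel sPU.
    apply: (@posterior_gt0 _ _ _ _ st PU _ _ y) => //.
    by rewrite mulr_gt0//; apply: lt_le_trans (st_ge y z); rewrite mulr_gt0// subr_gt0.
  have st_le : info st PU <= sup V.
    apply: ub_le_sup; first by case: V_sup.
    exists (mix t Q0 Q); first exact: mix_channel.
    rewrite /st; congr (info (yz_source _ _ _) _); apply/funext => x; apply/funext => j.
    by rewrite /Qth /mix; ring.
  (* The information at the mixture is affine in the two log-losses against [qt] and exceeds that at
     [Q0] by less than [t * e]; as [qt] cannot beat the posterior on [s0], the excess bounds the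
     loss on [s1]. *)
  have loss_t : log_loss s1 PU qt <= v + e.
    have h1 : info st PU = (1 - t) * log_loss s0 PU qt + t * log_loss s1 PU qt.
      exact: log_loss_mix.
    have h2 : info s0 PU <= log_loss s0 PU qt.
      apply: info_le_log_loss => //; first exact: posterior_ge0.
      exact: sum_posterior_le1.
    have h3 : info s0 PU <= v by apply: v_max; exact: Qthc.
    have h4 : (1 - t) * info s0 PU <= (1 - t) * log_loss s0 PU qt.
      by rewrite ler_pM2l// subr_gt0.
    rewrite -(ler_pM2l t0).
    have : t * info s0 PU <= t * v by rewrite ler_pM2l.
    by move: Q0max; lra.
  apply: (@le_trans _ _ (log_loss s1 PU qt + e)); last by lra.
  apply: log_loss_le => //; first exact: sum_yz_source (Qthc _ Qc).
  move=> y z u sPU; have q0 := q_gt0 _ _ _ _ Qc sPU.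
  have [s10 PU0] := mul_gt0_factors s1_ge0 PU_channel sPU.
  have s00 : 0 < s0 y z := s0_gt0 _ _ _ Qc s10.
  split=> //; first by apply: (qt_gt0 y); rewrite mulr_gt0.
  have m0 : 0 < mass s0 z by apply: lt_le_trans (le_mass s0_ge0 y z).
  have mt : (1 - t) * mass s0 z <= mass st z.
    by rewrite /mass mulr_sumr; apply: ler_sum => y' _; exact: st_ge.
  have t1' : 0 < 1 - t by rewrite subr_gt0.
  have mt0 : 0 < mass st z by apply: lt_le_trans mt; rewrite mulr_gt0.
  have ot : out_mass st PU z u <= (1 + t * c0) * out_mass s0 PU z u.
    rewrite /out_mass mulr_sumr; apply: ler_sum => y' _; rewrite mulrA.
    apply: ler_wpM2r; first by case: (PU_channel y').
    rewrite stE.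
    have : t * s1 y' z <= t * (c0 * s0 y' z) by rewrite ler_pM2l// sle.
    by have := mulr_ge0 (ltW t0) (s0_ge0 y' z); lra.
  have o0 : 0 <= out_mass s0 PU z u by exact: out_mass_ge0.
  rewrite /qt {1}/posterior ler_pdivrMr// /q /posterior.
  apply: le_trans ot _.
  have step1 : (1 + t * c0) <= expR e * (1 - t).
    apply: (@le_trans _ _ ((1 + e) * (1 - t))); last first.
      by rewrite ler_pM2r// expR_ge1Dx.
    have : t * e <= 1 / 2 * e by rewrite ler_pM2r.
    by move: tE t0 c00; nra.
  have -> : expR e * (out_mass s0 PU z u / mass s0 z) * mass st z =
      out_mass s0 PU z u * (expR e * (mass st z / mass s0 z)) by ring.
  rewrite mulrC ler_wpM2l//; apply: le_trans step1 _.
  by rewrite ler_pM2l ?expR_gt0// ler_pdivlMr.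
have opt Q : is_channel Q -> log_loss (source Q) PU q <= v + 3 * e.
  move=> Qc; have := near_opt _ Qc; rewrite log_loss_mix.
  have : 0 <= log_loss (source uniform_adversary) PU q.
    apply: (@le_trans _ _ (info (source uniform_adversary) PU)).
      by apply: info_ge0 => //; exact: s_ge0.
    apply: info_le_log_loss => //; first exact: s_ge0.
    - exact: posterior_ge0.
    - exact: sum_posterior_le1.
    - move=> y z u sPU; have [su PU0] := mul_gt0_factors (s_ge0 _ uc) PU_channel sPU.
      apply: (q_gt0 uniform_adversary y) => //; rewrite mulr_gt0//.
      rewrite yz_source_mix -mulrDl subrK mul1r; exact: su.
  move=> h1 h2; have h3 : (1 - th) * log_loss (source Q) PU q <= v + 2 * e.
    by apply: le_trans h2; rewrite lerDl mulr_ge0// ltW.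
  have th1' : 0 < 1 - th by rewrite subr_gt0.
  have h4 : v + 2 * e = (1 - th) * (v + 3 * e).
    by rewrite mulrBl mul1r /th divfK ?gt_eqF//; ring.
  by rewrite -(ler_pM2l th1') -h4.
have [u0 _] : exists u0 : U, True.
  have [x _] := dist_inhabited PX_dist; have [j _] := card_gt0P J_gt0.
  have [[y _] _] := dist_inhabited (W_channel (x, j)).
  exact: dist_inhabited (PU_channel y).
have U0 : 0 < #|U|%:R :> R by rewrite ltr0n; apply/card_gt0P; exists u0.
have k1 : expR (- e) < 1 by rewrite expR_lt1 oppr_lt0.
have k0 := expR_gt0 (- e).
(* Adding a little of the uniform law makes [q] positive everywhere; the factor [expR (- e)] costs
   [e] in log-loss. *)
exists (fun z u => expR (- e) * q z u + (1 - expR (- e)) / #|U|%:R).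
have p0 : 0 < (1 - expR (- e)) / #|U|%:R by rewrite divr_gt0// subr_gt0.
have q_ge0 z u : 0 <= q z u by exact: posterior_ge0.
split=> [z u|z|Q Qc].
- exact: ltr_wpDl (mulr_ge0 (ltW k0) (q_ge0 z u)) p0.
- rewrite big_split/= -mulr_sumr sumr_const -[X in _ + X]mulr_natr divfK ?gt_eqF//.
  rewrite -lerBrDr opprB addrCA subrr addr0 ger_pMr//.
  exact: sum_posterior_le1.
- apply: (@le_trans _ _ (log_loss (source Q) PU q + e)); last first.
    by have := opt _ Qc; rewrite /e; lra.
  apply: log_loss_le => //; [exact: s_ge0|exact: sum_yz_source|].
  move=> y z u sPU; have [s1 PU0] := mul_gt0_factors (s_ge0 _ Qc) PU_channel sPU.
  have q0 : 0 < q z u.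
    apply: (q_gt0 Q y) => //; rewrite mulr_gt0// yz_source_mix ltr_pwDl//.
      by rewrite mulr_gt0// subr_gt0.
    by rewrite mulr_ge0 ?s_ge0// ltW.
  split=> //; first exact: addr_gt0 (mulr_gt0 k0 q0) p0.
  rewrite mulrDr mulrA -expRD subrr expR0 mul1r lerDl mulr_ge0 ?expR_ge0//.
  exact: ltW.
Qed.

End Minimax.

(** * Direct coding *)

Lemma expR_le_quadratic (R : realType) (x : R) :
  `|x| <= 1 / 2 -> expR x <= 1 + x + 2 * x ^+ 2.
Proof.
rewrite ler_norml => /andP[x1 x2].
have x3 : 0 < 1 - x by lra.
have h : expR x <= (1 - x)^-1.
  by rewrite -[x in leLHS]opprK expRN lef_pV2 ?posrE ?expR_gt0// expR_ge1Dx.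
apply: le_trans h _; rewrite -(ler_pM2r x3) mulVf ?gt_eqF// expr2.
have : 0 <= x * x * (1 - 2 * x) by rewrite mulr_ge0 ?sqr_ge0// -?expr2 ?sqr_ge0//; lra.
lra.
Qed.

Lemma powR_prod (R : realType) (I : finType) (F : I -> R) (lam : R) :
  (forall i, 0 <= F i) -> (\prod_i F i) `^ lam = \prod_i F i `^ lam.
Proof.
move=> F0; suff [] : 0 <= \prod_i F i /\ (\prod_i F i) `^ lam = \prod_i F i `^ lam by [].
elim/big_rec2: _ => [|i y1 y2 _ [y20 <-]]; first by rewrite powR1.
by rewrite mulr_ge0// powRM.
Qed.

Lemma exp_decay (R : realType) (B a eps : R) : 0 <= B -> 0 < a -> 0 < eps ->
  exists n0, forall n, (n0 <= n)%N -> B * expR (- (n%:R * a)) <= eps.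
Proof.
move=> B0 a0 eps0; exists (Num.truncn (B / (eps * a))).+1 => n n0n.
have : B / (eps * a) <= n%:R.
  by apply: le_trans (ltW (truncnS_gt _)) _; rewrite ler_nat.
rewrite (ler_pdivrMr _ _ (mulr_gt0 eps0 a0)) => Bn.
rewrite expRN ler_pdivrMr ?expR_gt0//; apply: le_trans Bn _.
have -> : n%:R * (eps * a) = eps * (n%:R * a) by ring.
by rewrite ler_pM2l//; apply: le_trans (expR_ge1Dx _); rewrite lerDr.
Qed.

Lemma sum_prod_words3 (R : realType) (A B C : finType) n
    (F : 'I_n -> A -> B -> C -> R) :
  \sum_(a : word n A) \sum_(b : word n B) \sum_(c : word n C)
    \prod_i F i (a i) (b i) (c i) =
  \prod_i \sum_a \sum_b \sum_c F i a b c.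
Proof.
rewrite -sum_prod_words; apply: eq_bigr => a _; apply: eq_bigr => b _.
by rewrite bigA_distr_bigA.
Qed.

Lemma mean_words3 (R : realType) (A B C : finType) n
    (p f : 'I_n -> A -> B -> C -> R) :
  (forall i, \sum_a \sum_b \sum_c p i a b c = 1) ->
  \sum_(a : word n A) \sum_(b : word n B) \sum_(c : word n C)
    (\prod_i p i (a i) (b i) (c i)) * \sum_i f i (a i) (b i) (c i) =
  \sum_i \sum_a \sum_b \sum_c p i a b c * f i a b c.
Proof.
move=> p1.
under eq_bigr do under eq_bigr do under eq_bigr do rewrite mulr_sumr.
under eq_bigr do under eq_bigr do rewrite exchange_big/=.
under eq_bigr do rewrite exchange_big/=.
rewrite exchange_big/=; apply: eq_bigr => i _.
pose F k a b c := p k a b c * (if k == i then f i a b c else 1).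
transitivity (\prod_k \sum_a \sum_b \sum_c F k a b c).
  rewrite -sum_prod_words3; apply: eq_bigr => a _; apply: eq_bigr => b _.
  apply: eq_bigr => c _.
  have -> : \prod_k F k (a k) (b k) (c k) = (\prod_k p k (a k) (b k) (c k)) *
      \prod_k (if k == i then f i (a k) (b k) (c k) else 1) by rewrite -big_split.
  by congr (_ * _); rewrite (bigD1 i)//= eqxx big1 ?mulr1// => k /negbTE ->.
rewrite (bigD1 i)//= /F eqxx [X in _ * X]big1 ?mulr1// => k /negbTE ->.
rewrite -[RHS](p1 k); apply: eq_bigr => a _; apply: eq_bigr => b _.
by apply: eq_bigr => c _; rewrite mulr1.
Qed.

Lemma mean_words1 (R : realType) (A : finType) n (p f : 'I_n -> A -> R) :
  (forall i, \sum_a p i a = 1) ->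
  \sum_(a : word n A) (\prod_i p i (a i)) * \sum_i f i (a i) =
  \sum_i \sum_a p i a * f i a.
Proof.
move=> p1; under eq_bigr do rewrite mulr_sumr.
rewrite exchange_big/=; apply: eq_bigr => i _.
pose F k a := p k a * (if k == i then f i a else 1).
transitivity (\prod_k \sum_a F k a).
  rewrite (bigA_distr_bigA F); apply: eq_bigr => a _.
  rewrite big_split/=; congr (_ * _).
  by rewrite (bigD1 i)//= eqxx big1 ?mulr1// => k /negbTE ->.
rewrite (bigD1 i)//= /F eqxx [X in _ * X]big1 ?mulr1// => k /negbTE ->.
by rewrite -[RHS](p1 k); apply: eq_bigr => a _; rewrite mulr1.
Qed.

Lemma mean_push (R : realType) (Omega T : finType) (w : Omega -> R) (g : Omega -> T)
    (f : T -> R) :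
  \sum_t (\sum_(o | g o == t) w o) * f t = \sum_o w o * f (g o).
Proof.
rewrite [RHS](partition_big g xpredT)//=; apply: eq_bigr => t _.
by rewrite mulr_suml; apply: eq_bigr => o /eqP ->.
Qed.

Section Direct.
Context (R : realType) (X Y Z J Xt U : finType).
Context (PX : X -> R) (W : X * J -> Y * Z -> R) (d : X -> Xt -> R).
Context (PU : Y -> U -> R) (xt : U -> Z -> Xt).
Hypothesis PX_dist : is_dist PX.
Hypothesis W_channel : is_channel W.
Hypothesis d_ge0 : forall x xt, 0 <= d x xt.
Hypothesis PU_channel : is_channel PU.
Hypothesis J_gt0 : (0 < #|J|)%N.

Notation source := (yz_source PX W).

Let PX_ge0 x : 0 <= PX x. Proof. by case: PX_dist. Qed.
Let W_ge0 p q : 0 <= W p q. Proof. by case: (W_channel p). Qed.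
Let PU_ge0 y u : 0 <= PU y u. Proof. by case: (PU_channel y). Qed.

(** Expectation over (Y, Z, U) given one letter of the source and one of the adversary: the
    adversary acts on a product bound only through these numbers. *)
Definition letter_mean (x : X) (j : J) (f : Y -> Z -> U -> R) : R :=
  \sum_y \sum_z \sum_u W (x, j) (y, z) * PU y u * f y z u.

Lemma letter_mean1 x j : \sum_y \sum_z \sum_u W (x, j) (y, z) * PU y u = 1.
Proof.
rewrite -(sum_channel2 W_channel x j); apply: eq_bigr => y _; apply: eq_bigr => z _.
by rewrite -mulr_sumr; case: (PU_channel y) => _ ->; rewrite mulr1.
Qed.

Lemma letter_mean_le x j (f g : Y -> Z -> U -> R) :
  (forall y z u, 0 < PU y u -> f y z u <= g y z u) ->
  letter_mean x j f <= letter_mean x j g.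
Proof.
move=> fg; apply: ler_sum => y _; apply: ler_sum => z _; apply: ler_sum => u _.
have [PU0|] := ltP 0 (PU y u); last first.
  by rewrite le_eqVlt ltNge PU_ge0 orbF => /eqP ->; rewrite !mulr0 !mul0r.
by rewrite ler_wpM2l ?mulr_ge0// fg.
Qed.

Lemma sum_letter_mean Q (f : X -> Y -> Z -> U -> R) :
  \sum_x PX x * \sum_j Q x j * letter_mean x j (f x) =
  \sum_x \sum_j \sum_y \sum_z \sum_u jointU PX W PU Q x j y z u * f x y z u.
Proof.
apply: eq_bigr => x _; rewrite mulr_sumr; apply: eq_bigr => j _.
rewrite mulrA mulr_sumr; apply: eq_bigr => y _.
rewrite mulr_sumr; apply: eq_bigr => z _.
rewrite mulr_sumr; apply: eq_bigr => u _.
by rewrite /jointU /joint; ring.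
Qed.

Lemma aux_distortion_letter_mean Q : aux_distortion PX W d PU xt Q =
  \sum_x PX x * \sum_j Q x j * letter_mean x j (fun _ z u => d x (xt u z)).
Proof. by rewrite (sum_letter_mean _ (fun x _ z u => d x (xt u z))). Qed.

Lemma log_loss_letter_mean Q (q : Z -> U -> R) : log_loss (source Q) PU q =
  \sum_x PX x * \sum_j Q x j * letter_mean x j (fun y z u => ln (PU y u / q z u)).
Proof.
rewrite (sum_letter_mean _ (fun _ y z u => ln (PU y u / q z u))) exchange_sum2.
apply: eq_bigr => y _; apply: eq_bigr => z _.
rewrite pair_bigA/= exchange_big/=; apply: eq_bigr => u _.
rewrite -(pair_bigA _ (fun x j =>
  jointU PX W PU Q x j y z u * ln (PU y u / q z u))) mulr_suml mulr_suml.
by apply: eq_bigr => x _; rewrite mulr_suml mulr_suml.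
Qed.

Lemma aux_distortion_le_dmax Q : is_channel Q ->
  aux_distortion PX W d PU xt Q <= dmax d.
Proof.
move=> Qc; rewrite aux_distortion_letter_mean.
apply: mean_le => // x; apply: mean_le => // j.
apply: (@le_trans _ _ (letter_mean x j (fun _ _ _ => dmax d))).
  by apply: letter_mean_le => *; exact: le_dmax.
rewrite /letter_mean -[leRHS]mul1r -[X in _ <= X * _](letter_mean1 x j) mulr_suml.
apply: ler_sum => y _; rewrite mulr_suml; apply: ler_sum => z _.
by rewrite mulr_suml.
Qed.

(* The adversary's best reply is deterministic, letter by letter. *)
Lemma adversary_bound (g : X -> J -> R) (b : R) :
  (forall Q, is_channel Q -> \sum_x PX x * \sum_j Q x j * g x j <= b) ->
  exists h : X -> R, (forall x j, g x j <= h x) /\ \sum_x PX x * h x <= b.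
Proof.
move=> g_le; have [j0 _] := card_gt0P J_gt0.
pose jm x := [arg max_(j > j0) g x j]%O.
exists (fun x => g x (jm x)); split=> [x j|].
  by rewrite /jm; case: arg_maxP => // i _ /(_ j); exact.
have Qc : is_channel (fun x j => (j == jm x)%:R : R).
  move=> x; split=> [j|]; first exact: ler0n.
  by rewrite (bigD1 (jm x))//= eqxx big1 ?addr0// => j /negbTE ->.
apply: le_trans (g_le _ Qc); rewrite le_eqVlt; apply/orP; left; apply/eqP.
apply: eq_bigr => x _; rewrite (bigD1 (jm x))//= eqxx mul1r big1 ?addr0// => j.
by move=> /negbTE ->; rewrite mul0r.
Qed.

(* Chernoff: to first order in [lam] the moment is 1 plus [lam] times the
   log-loss, so one [lam] serves all choices of the adversary. *)
Lemma moment_bound (q : Z -> U -> R) (b e : R) :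
  (forall z u, 0 < q z u) -> 0 < e ->
  (forall Q, is_channel Q -> log_loss (source Q) PU q <= b) ->
  exists (lam : R) (H : X -> R), [/\ 0 < lam <= 1,
    forall x j, letter_mean x j (fun y z u => (PU y u / q z u) `^ lam) <= H x &
    \sum_x PX x * H x <= expR (lam * (b + e))].
Proof.
move=> q0 e0 loss_le.
have [|h [gh Eh]] := @adversary_bound (fun x j =>
    letter_mean x j (fun y z u => ln (PU y u / q z u))) b.
  by move=> Q Qc; rewrite -log_loss_letter_mean; exact: loss_le.
pose l (p : Y * Z * U) : R := `|ln (PU p.1.1 p.2 / q p.1.2 p.2)|.
pose B := \sum_p l p.
have l_le y z u : `|ln (PU y u / q z u)| <= B.
  by apply: (le_term_sum (F := l) _ (y, z, u)) => p; exact: normr_ge0.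
have B0 : 0 <= B by apply: sumr_ge0 => p _; exact: normr_ge0.
(* Its inverse [lam] satisfies [lam <= 1], [lam * B <= 1 / 2], as the quadratic bound on [expR]
   demands, and [lam * (2 * B ^+ 2) <= e], which absorbs the quadratic term. *)
pose k := 1 + 2 * B + 2 * B ^+ 2 / e.
have k1 : 1 <= k by rewrite /k -addrA lerDl addr_ge0 ?mulr_ge0 ?invr_ge0 ?sqr_ge0// ltW.
have k0 : 0 < k by exact: lt_le_trans k1.
pose lam := k^-1.
have lam0 : 0 < lam by rewrite invr_gt0.
have lam1 : lam <= 1 by rewrite invf_le1.
have lamk : lam * k = 1 by rewrite mulVf// gt_eqF.
have Be0 : 0 <= B ^+ 2 / e by rewrite divr_ge0 ?sqr_ge0// ltW.
have lamB : lam * B <= 1 / 2.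
  have : lam * (2 * B) <= lam * k by rewrite ler_pM2l// /k; lra.
  by rewrite lamk; lra.
have lamB2 : lam * (2 * B ^+ 2) <= e.
  have : lam * (2 * (B ^+ 2 / e)) <= lam * k.
    by rewrite ler_pM2l// /k -mulrA lerDr; lra.
  rewrite lamk => lamBe.
  have -> : lam * (2 * B ^+ 2) = lam * (2 * (B ^+ 2 / e)) * e by field; rewrite gt_eqF.
  by rewrite ler_piMl// ltW.
exists lam, (fun x => 1 + lam * h x + lam * e); split=> [|x j|].
- by rewrite lam0 lam1.
- apply: (@le_trans _ _ (letter_mean x j (fun y z u =>
      1 + lam * ln (PU y u / q z u) + lam * e))).
    apply: letter_mean_le => y z u PU0.
    have b0 : 0 < PU y u / q z u by rewrite divr_gt0.
    rewrite /powR gt_eqF//; apply: le_trans (expR_le_quadratic _) _.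
      rewrite normrM (gtr0_norm lam0); apply: le_trans lamB.
      by rewrite ler_pM2l.
    have -> : 2 * (lam * ln (PU y u / q z u)) ^+ 2 =
        lam * (lam * (2 * ln (PU y u / q z u) ^+ 2)) by ring.
    rewrite lerD2l (ler_pM2l lam0); apply: le_trans lamB2.
    rewrite (ler_pM2l lam0) ler_pM2l//.
    by rewrite -[leLHS]real_normK ?num_real// ler_sqr ?nnegrE.
  rewrite /letter_mean.
  have -> : \sum_y \sum_z \sum_u W (x, j) (y, z) * PU y u *
      (1 + lam * ln (PU y u / q z u) + lam * e) = 1 + lam *
      letter_mean x j (fun y z u => ln (PU y u / q z u)) + lam * e.
    have -> : 1 + lam * letter_mean x j (fun y z u => ln (PU y u / q z u)) + lam * e =
       (1 + lam * e) * \sum_y \sum_z \sum_u W (x, j) (y, z) * PU y u + lam *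
      letter_mean x j (fun y z u => ln (PU y u / q z u)) by rewrite letter_mean1; ring.
    rewrite /letter_mean !mulr_sumr -big_split; apply: eq_bigr => y _ /=.
    rewrite !mulr_sumr -big_split; apply: eq_bigr => z _ /=.
    by rewrite !mulr_sumr -big_split; apply: eq_bigr => u _ /=; ring.
  by rewrite lerD2r lerD2l ler_pM2l.
apply: le_trans (expR_ge1Dx _).
have -> : \sum_x PX x * (1 + lam * h x + lam * e) =
    (1 + lam * e) * \sum_x PX x + lam * \sum_x PX x * h x.
  by rewrite !mulr_sumr -big_split; apply: eq_bigr => x _ /=; ring.
case: PX_dist => _ ->; rewrite mulr1 -addrA lerD2l mulrDr addrC lerD2r.
by rewrite ler_pM2l.
Qed.

(** One-shot coding applied to whole words, with product kernels and the word distortion as cost. *)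
Lemma code_error_bound n M (lam eta : R) (q : Z -> U -> R) (h H : X -> R) (u0 : U) :
  (0 < n)%N -> (0 < M)%N -> 0 < lam <= 1 -> 0 < eta < 1 ->
  (forall z u, 0 < q z u) -> (forall z, \sum_u q z u <= 1) ->
  (forall x j, letter_mean x j (fun _ z u => d x (xt u z)) <= h x) ->
  (forall x j, letter_mean x j (fun y z u => (PU y u / q z u) `^ lam) <= H x) ->
  exists C : Defs.code n M Y Z Xt -> R, is_dist C /\
    max_code_distortion PX W d C <= \sum_x PX x * h x +
      dmax d * (M%:R^-1 `^ lam * (\sum_x PX x * H x) ^+ n) + eta * dmax d.
Proof.
move=> n0 M0 /andP[lam0 lam1] eta01 q0 q1 h_ge H_ge.
pose P (y : word n Y) (u : word n U) := \prod_i PU (y i) (u i).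
pose qn (z : word n Z) (u : word n U) := \prod_i q (z i) (u i).
have Pc : is_channel P.
  move=> y; split=> [u|]; first exact: prodr_ge0.
  by rewrite -(bigA_distr_bigA (fun i => PU (y i))) big1// => i _; case: (PU_channel (y i)).
have qn0 z u : 0 < qn z u by apply: prodr_gt0.
have qn1 z : \sum_u qn z u <= 1.
  rewrite -(bigA_distr_bigA (fun i => q (z i))); apply: prodr_ile1 => i _.
  by rewrite q1 sumr_ge0// => u _; exact: ltW.
have lam01 : 0 <= lam <= 1 by rewrite ltW.
have [S [w [enc [dec [wd Ew]]]]] :=
  @one_shot_coding R (word n Y) (word n Z) (word n U) M P qn [ffun=> u0] lam eta
    (dmax d) M0 Pc qn0 qn1 lam01 eta01.
pose code o : Defs.code n M Y Z Xt :=
  ([ffun y => enc o y], [ffun p => [ffun i => xt (dec o p.1 p.2 i) (p.2 i)]]).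
(* The shared randomness is pushed forward to codes, since different outcomes may give the same
   code. *)
exists (fun c => \sum_(o | code o == c) w o); case: (wd) => w_ge0 w1.
have Cd : is_dist (fun c => \sum_(o | code o == c) w o).
  split=> [c|]; first exact: sumr_ge0.
  by rewrite -w1 [RHS](partition_big code xpredT).
split=> //; apply: ge_sup.
  have [Q Qc] := @exists_adversary R X J J_gt0.
  eexists; exists (@iid_adversary _ _ _ Q n) => //=.
  exact: iid_adversary_channel.
move=> _ [Q Qc <-]; rewrite code_distortionE.
set Mlam := M%:R^-1 `^ lam; have Mlam0 : 0 <= Mlam by exact: powR_ge0.
have dmax0 := dmax_ge0 d_ge0.
(* This bound does not involve [j], so averaging over any non-causal strategy preserves it. *)
pose bound (x : word n X) := n%:R^-1 * (\sum_i h (x i)) +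
  (dmax d * Mlam * (\prod_i H (x i)) + eta * dmax d).
have inner (x : word n X) (j : word n J) : \sum_(y : word n Y) \sum_(z : word n Z)
    (\prod_i W (x i, j i) (y i, z i)) * \sum_c (\sum_(o | code o == c) w o) *
      word_distortion d x (decoded c y z) <= bound x.
  pose cost (u : word n U) (z : word n Z) := \sum_i d (x i) (xt (u i) (z i)).
  pose WP (y : word n Y) (z : word n Z) (u : word n U) :=
    \prod_i (W (x i, j i) (y i, z i) * PU (y i) (u i)).
  pose beta (y : word n Y) (z : word n Z) (u : word n U) :=
    \prod_i (PU (y i) (u i) / q (z i) (u i)) `^ lam.
  have WPE y z u : WP y z u = (\prod_i W (x i, j i) (y i, z i)) * P y u.
    exact: big_split.
  apply: (@le_trans _ _ (\sum_y \sum_z \sum_u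
      (n%:R^-1 * (WP y z u * cost u z) +
       (dmax d * Mlam * (WP y z u * beta y z u) + eta * dmax d * WP y z u)))).
    apply: ler_sum => y _; apply: ler_sum => z _; rewrite mean_push.
    have W0 : 0 <= \prod_i W (x i, j i) (y i, z i) by exact: prodr_ge0.
    have := Ew y z (fun u => word_distortion d x [ffun i => xt (u i) (z i)]).
    have bnd u : 0 <= word_distortion d x [ffun i => xt (u i) (z i)] <= dmax d.
      by rewrite word_distortion_ge0//= word_distortion_le.
    move=> /(_ bnd) Eyz.
    have -> : \sum_o w o * word_distortion d x (decoded (code o) y z) =
        \sum_o w o * word_distortion d x
          [ffun i => xt (dec o (enc o y) z i) (z i)].
      by apply: eq_bigr => o _; rewrite /decoded/= !ffunE.
    apply: le_trans (ler_wpM2l W0 Eyz) _.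
    rewrite le_eqVlt; apply/orP; left; apply/eqP.
    have [_ P1] := Pc y.
    rewrite -[X in _ + X]mulr1 -[X in _ + _ * X]P1 !mulr_sumr -!big_split mulr_sumr.
    apply: eq_bigr => u _ /=; rewrite WPE.
    have -> : P y u / (M%:R * qn z u) =
        M%:R^-1 * \prod_i (PU (y i) (u i) / q (z i) (u i)).
      by rewrite prodf_div invfM mulrCA.
    have b_ge0 i : 0 <= PU (y i) (u i) / q (z i) (u i) by rewrite divr_ge0// ltW.
    rewrite powRM ?invr_ge0 ?prodr_ge0// powR_prod// /word_distortion.
    have -> : \sum_i d (x i) ([ffun i => xt (u i) (z i)] i) = cost u z.
      by apply: eq_bigr => i _; rewrite ffunE.
    by rewrite -/Mlam /beta; ring.
  have -> : \sum_y \sum_z \sum_u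
      (n%:R^-1 * (WP y z u * cost u z) +
       (dmax d * Mlam * (WP y z u * beta y z u) + eta * dmax d * WP y z u)) =
     n%:R^-1 * (\sum_y \sum_z \sum_u WP y z u * cost u z) +
       (dmax d * Mlam * (\sum_y \sum_z \sum_u WP y z u * beta y z u) +
        eta * dmax d * \sum_y \sum_z \sum_u WP y z u).
    rewrite !mulr_sumr -!big_split; apply: eq_bigr => y _ /=.
    rewrite !mulr_sumr -!big_split; apply: eq_bigr => z _ /=.
    by rewrite !mulr_sumr -!big_split; apply: eq_bigr => u _ /=.
  have -> : \sum_y \sum_z \sum_u WP y z u * cost u z =
      \sum_i letter_mean (x i) (j i) (fun _ z u => d (x i) (xt u z)).
    apply: (mean_words3 (p := fun i y z u => W (x i, j i) (y, z) * PU y u)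
      (fun i _ z u => d (x i) (xt u z))) => i.
    exact: letter_mean1.
  have -> : \sum_y \sum_z \sum_u WP y z u * beta y z u =
      \prod_i letter_mean (x i) (j i) (fun y z u => (PU y u / q z u) `^ lam).
    rewrite -(sum_prod_words3 (fun i y z u =>
      W (x i, j i) (y, z) * PU y u * (PU y u / q z u) `^ lam)).
    apply: eq_bigr => y _; apply: eq_bigr => z _; apply: eq_bigr => u _.
    by rewrite -big_split.
  have -> : \sum_y \sum_z \sum_u WP y z u = 1.
    rewrite (sum_prod_words3 (fun i y z u => W (x i, j i) (y, z) * PU y u)).
    by rewrite big1// => i _; exact: letter_mean1.
  rewrite mulr1; apply: lerD; last first.
    rewrite lerD2r; apply: ler_wpM2l; first exact: mulr_ge0.
    apply: ler_prod => i _; rewrite H_ge andbT.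
    apply: sumr_ge0 => y _; apply: sumr_ge0 => z _; apply: sumr_ge0 => u _.
    by rewrite !mulr_ge0// powR_ge0.
  by rewrite ler_wpM2l ?invr_ge0//; apply: ler_sum => i _; exact: h_ge.
apply: (@le_trans _ _ (\sum_(x : word n X) (\prod_i PX (x i)) * bound x)).
  apply: ler_sum => x _; apply: ler_wpM2l; first exact: prodr_ge0.
  by apply: mean_le => // j; exact: inner.
rewrite le_eqVlt; apply/orP; left; apply/eqP.
have [_ PXn1] := words_PX_dist PX_dist n.
rewrite -[X in _ = _ + X]mulr1 -[X in _ = _ + _ * X]PXn1.
have -> : (\sum_x PX x * H x) ^+ n =
    \sum_(x : word n X) (\prod_i PX (x i)) * \prod_i H (x i).
  rewrite -[in LHS](card_ord n) -prodr_const.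
  rewrite (bigA_distr_bigA (fun _ x => PX x * H x)).
  by apply: eq_bigr => x _; rewrite big_split.
have -> : \sum_x PX x * h x = n%:R^-1 *
    \sum_(x : word n X) (\prod_i PX (x i)) * \sum_i h (x i).
  rewrite (mean_words1 (p := fun _ => PX) (fun _ => h)) => [|i]; last by case: PX_dist.
  rewrite sumr_const card_ord -[X in _ = _ * X]mulr_natl mulrA mulVf ?mul1r//.
  by rewrite pnatr_eq0 -lt0n.
rewrite /bound; move: (dmax d) => dm.
rewrite !mulr_sumr -!big_split; apply: eq_bigr => x _ /=.
by ring.
Qed.

Lemma num_messages_gt0 n (r : R) : 0 <= r -> (0 < num_messages n r)%N.
Proof.
by move=> r0; rewrite truncn_gt0 -[leLHS](powRr0 2) ler_powR ?ler1n// mulr_ge0.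
Qed.

(** Rounding a number that is at least 1 down to an integer at most halves it, whence the factor
    2. *)
Lemma inv_num_messages_powR_le n (r lam : R) : 0 <= r -> 0 <= lam <= 1 ->
  (num_messages n r)%:R^-1 `^ lam <= 2 * expR (- (n%:R * (lam * (r * ln 2)))).
Proof.
move=> r0 /andP[lam0 lam1]; set M := num_messages n r; set p := 2 `^ (n%:R * r).
have p1 : 1 <= p by rewrite -(powRr0 2) ler_powR ?ler1n// mulr_ge0.
have p0 : 0 < p by exact: lt_le_trans p1.
have M0 : (0 < M)%N by exact: num_messages_gt0.
have M0' : 0 < M%:R :> R by rewrite ltr0n.
have pM : p <= 2 * M%:R.
  apply: le_trans (ltW (truncnS_gt _)) _; rewrite -/p -/(num_messages n r) -/M.
  by rewrite -natrM ler_nat mul2n -addnn -addn1 leq_add2l.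
apply: (@le_trans _ _ ((2 * p^-1) `^ lam)).
  apply: ge0_ler_powR; rewrite ?nnegrE ?mulr_ge0 ?invr_ge0 ?(ltW M0') ?(ltW p0)//.
  by rewrite -(ler_pM2r M0') mulVf ?gt_eqF// mulrAC ler_pdivlMr// mul1r.
rewrite powRM ?invr_ge0 ?(ltW p0)//.
apply: ler_pM; rewrite ?powR_ge0//; first by apply: ler1_powR => //; rewrite ler1n.
rewrite -powRN -powRrM /powR pnatr_eq0/= ler_expR le_eqVlt; apply/orP; left.
by apply/eqP; ring.
Qed.

Lemma direct_coding (D v r : R) :
  (forall Q, is_channel Q -> aux_distortion PX W d PU xt Q <= D) ->
  (forall Q, is_channel Q -> aux_info PX W PU Q <= v) ->
  v < r -> achievable PX W d D r.
Proof.
move=> D_ge v_ge vr eps eps0.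
have ln2 : 0 < ln 2 :> R by rewrite ln_gt0// ltr1n.
have info_le Q : is_channel Q -> info (source Q) PU <= v * ln 2.
  by move=> Qc; rewrite -ler_pdivrMr// -aux_infoE//; exact: v_ge.
have r0 : 0 <= r.
  have [Q Qc] := @exists_adversary R X J J_gt0.
  apply: le_trans (ltW vr); rewrite -(pmulr_lge0 _ ln2).
  apply: le_trans (info_le _ Qc); apply: info_ge0 => // y z.
  exact: yz_source_ge0.
(* A quarter of the rate gap in nats: [minimax] and [moment_bound] spend one quarter each, and the
   remaining [2 * e] gives the exponential decay. *)
pose e := (r - v) * ln 2 / 4.
have e0 : 0 < e by rewrite divr_gt0// mulr_gt0// subr_gt0.
have [q [q0 q1 loss_le]] := minimax PX_dist W_channel PU_channel J_gt0 info_le e0.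
have [lam [H [/andP[lam0 lam1] H_ge EH]]] := moment_bound q0 e0 loss_le.
have [|h [h_ge Eh]] := @adversary_bound (fun x j =>
    letter_mean x j (fun _ z u => d x (xt u z))) D.
  by move=> Q Qc; rewrite -aux_distortion_letter_mean; exact: D_ge.
have [u0 _] : exists u0 : U, True.
  have [x _] := dist_inhabited PX_dist; have [j _] := card_gt0P J_gt0.
  have [[y _] _] := dist_inhabited (W_channel (x, j)).
  exact: dist_inhabited (PU_channel y).
have dmax0 := dmax_ge0 d_ge0.
have eps2 : 0 < eps / 2 by rewrite divr_gt0.
have a0 : 0 < lam * (2 * e) by rewrite mulr_gt0// mulr_gt0.
have [n0 decay] := exp_decay (mulr_ge0 dmax0 (ler0n _ 2)) a0 eps2.
(* This makes [eta * dmax d <= eps / 2] and [eta < 1], also when [dmax d] is 0. *)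
pose eta := eps / (2 * dmax d + 2 * eps).
have eta_den : 0 < 2 * dmax d + 2 * eps by rewrite ltr_wpDl ?mulr_ge0// mulr_gt0.
have eta0 : 0 < eta by rewrite divr_gt0.
have eta1 : eta < 1 by rewrite ltr_pdivrMr//; lra.
have etaD : eta * dmax d <= eps / 2.
  have : eta * (2 * dmax d + 2 * eps) = eps by rewrite divfK// gt_eqF.
  by have := mulr_ge0 (ltW eta0) (ltW eps0); lra.
exists n0.+1 => n n0n.
have M0 := num_messages_gt0 n r0.
have [||C [Cd C_le]] := code_error_bound u0 (leq_ltn_trans (leq0n n0) n0n) M0 _ _
  q0 q1 h_ge H_ge (lam := lam) (eta := eta); rewrite ?lam0 ?eta0//.
exists C; split=> //; apply: le_trans C_le _.
have lam01 : 0 <= lam <= 1 by rewrite ltW.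
have H_ge0 x : 0 <= H x.
  have [j _] := card_gt0P J_gt0; apply: le_trans (H_ge x j).
  apply: sumr_ge0 => y _; apply: sumr_ge0 => z _; apply: sumr_ge0 => u _.
  by rewrite !mulr_ge0// powR_ge0.
have EH0 : 0 <= \sum_x PX x * H x by apply: sumr_ge0 => x _; rewrite mulr_ge0.
have err : (num_messages n r)%:R^-1 `^ lam * (\sum_x PX x * H x) ^+ n <=
    2 * expR (- (n%:R * (lam * (2 * e)))).
  have -> : expR (- (n%:R * (lam * (2 * e)))) =
      expR (- (n%:R * (lam * (r * ln 2)))) * expR (lam * (v * ln 2 + e + e)) ^+ n.
    by rewrite -expRM_natl -expRD; congr expR; rewrite /e; field.
  rewrite mulrA; apply: ler_pM; rewrite ?powR_ge0 ?exprn_ge0//.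
    exact: inv_num_messages_powR_le.
  by apply: lerXn2r; rewrite ?nnegrE ?expR_ge0.
have := decay n (ltnW n0n); have := ler_wpM2l dmax0 err.
by move: Eh etaD; rewrite mulrA; lra.
Qed.

End Direct.

(** The infimum over decoders is attained because they are enumerated by a finite type. Attainment
    matters at the endpoint [D = D0]. *)
Lemma inf_le_exists (R : realType) (T : finType) (S : Type) (f : T -> S) (F : S -> R)
    (s0 : S) (a : R) :
  (forall s, exists t, f t = s) -> inf [set F s | s in [set: S]] <= a ->
  exists s, F s <= a.
Proof.
move=> f_surj inf_le; have [t0 _] := f_surj s0.
pose t := [arg min_(t < t0) F (f t)]%O.
exists (f t); apply: le_trans inf_le; apply: lb_le_inf; first by exists (F s0), s0.
move=> _ [s _ <-]; have [t' <-] := f_surj s.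
by rewrite /t; case: arg_minP => // i _; exact.
Qed.

(** * Assembling the two inequalities *)

Section Bounds.
Context (R : realType) (X Y Z J Xt : finType).
Context (PX : X -> R) (W : X * J -> Y * Z -> R) (d : X -> Xt -> R).
Hypothesis PX_dist : is_dist PX.
Hypothesis W_channel : is_channel W.
Hypothesis d_ge0 : forall x xt, 0 <= d x xt.
Hypothesis J_gt0 : (0 < #|J|)%N.
Hypothesis Xt_gt0 : (0 < #|Xt|)%N.

Definition trivial_channel (y : Y) (u : unit) : R := 1.

Lemma trivial_channelP : is_channel trivial_channel.
Proof. by move=> y; split=> [u|]; rewrite ?ler01// big_const card_unit/= addr0. Qed.

Definition identity_channel (y u : Y) : R := (y == u)%:R.

Lemma identity_channelP : is_channel identity_channel.
Proof.
move=> y; split=> [u|]; first exact: ler0n.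
by rewrite /identity_channel (bigD1 y)//= eqxx big1 ?addr0// => u;
  rewrite eq_sym => /negbTE ->.
Qed.

Lemma aux_distortion_trivial (xt : Z -> Xt) Q :
  \sum_x \sum_j \sum_y \sum_z joint PX W Q x j y z * d x (xt z) =
  aux_distortion PX W d trivial_channel (fun _ => xt) Q.
Proof.
apply: eq_bigr => x _; apply: eq_bigr => j _; apply: eq_bigr => y _.
apply: eq_bigr => z _.
by rewrite /jointU /trivial_channel big_const card_unit/= addr0 mulr1.
Qed.

Lemma aux_distortion_identity (xt : Y -> Z -> Xt) Q :
  \sum_x \sum_j \sum_y \sum_z joint PX W Q x j y z * d x (xt y z) =
  aux_distortion PX W d identity_channel xt Q.
Proof.
apply: eq_bigr => x _; apply: eq_bigr => j _; apply: eq_bigr => y _.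
apply: eq_bigr => z _; rewrite (bigD1 y)//= /jointU /identity_channel eqxx mulr1.
by rewrite big1 ?addr0// => u; rewrite eq_sym => /negbTE ->; rewrite mulr0 mul0r.
Qed.

Lemma aux_distortion_le_sup (U : finType) (PU : Y -> U -> R) (xt : U -> Z -> Xt) Q :
  is_channel PU -> is_channel Q -> aux_distortion PX W d PU xt Q <=
  sup [set aux_distortion PX W d PU xt Q | Q in [set Q | is_channel Q]].
Proof.
move=> PUc Qc; apply: ub_le_sup; last by exists Q.
by exists (dmax d) => _ [Q' Q'c <-]; exact: aux_distortion_le_dmax.
Qed.

Lemma aux_info_ge0 (U : finType) (PU : Y -> U -> R) Q :
  is_channel PU -> is_channel Q -> 0 <= aux_info PX W PU Q.
Proof.
move=> PUc Qc; rewrite aux_infoE// divr_ge0 ?ln_ge0 ?ler1n//.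
by apply: info_ge0 => // y z; exact: yz_source_ge0.
Qed.

Lemma aux_info_le (U : finType) (PU : Y -> U -> R) Q :
  is_channel PU -> is_channel Q -> aux_info PX W PU Q <= ln #|U|%:R / ln 2.
Proof.
move=> PUc Qc; have ln2 : 0 < ln 2 :> R by rewrite ln_gt0// ltr1n.
rewrite aux_infoE// ler_pM2r ?invr_gt0//; apply: info_le_ln_card => //.
  by move=> y z; exact: yz_source_ge0.
exact: sum_yz_source.
Qed.

Lemma exists_D0_decoder D : D0 PX W d <= D -> exists xt : Y -> Z -> Xt,
  forall Q, is_channel Q -> aux_distortion PX W d identity_channel xt Q <= D.
Proof.
have [t0 _] := card_gt0P Xt_gt0.
move=> /(@inf_le_exists _ {ffun Y * Z -> Xt} _ (fun f y z => f (y, z)) _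
  (fun _ _ => t0)); case=> [s|xt xtD].
  exists [ffun p => s p.1 p.2].
  by apply/funext => y; apply/funext => z; rewrite ffunE.
exists xt => Q Qc; apply: le_trans xtD.
under [X in _ <= sup X]eq_imagel do rewrite aux_distortion_identity.
apply: aux_distortion_le_sup => //; exact: identity_channelP.
Qed.

Lemma exists_D1_decoder D : D1 PX W d < D -> exists xt : Z -> Xt,
  forall Q, is_channel Q ->
  aux_distortion PX W d trivial_channel (fun _ => xt) Q <= D.
Proof.
have [t0 _] := card_gt0P Xt_gt0.
move=> /inf_lt[|_ [xt _ <-] xtD]; first by eexists; exists (fun _ => t0).
exists xt => Q Qc; apply: le_trans (ltW xtD).
under [X in _ <= sup X]eq_imagel do rewrite aux_distortion_trivial.
apply: aux_distortion_le_sup => //; exact: trivial_channelP.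
Qed.

(** Taking U = Y shows that the set of achievable rates is nonempty, without which its infimum would
    have no meaning as a bound. *)
Lemma exists_achievable D : D0 PX W d <= D -> exists r, achievable PX W d D r.
Proof.
move=> /exists_D0_decoder[xt xtD]; exists (ln #|Y|%:R / ln 2 + 1).
apply: (direct_coding PX_dist W_channel d_ge0 identity_channelP J_gt0 xtD (v := ln #|Y|%:R / ln 2)).
  by move=> Q Qc; apply: aux_info_le => //; exact: identity_channelP.
by rewrite ltrDl.
Qed.

Lemma rate_distortion_le D r : achievable PX W d D r -> rate_distortion PX W d D <= r.
Proof.
move=> ach; apply: ge_inf => //; exists 0 => r' ach'.
exact: (achievable_ge0 PX_dist W_channel J_gt0 ach').
Qed.

Lemma rate_distortion_le_RU D : D0 PX W d <= D ->
  rate_distortion PX W d D <= RU PX W d D.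
Proof.
move=> D_ge; rewrite /RU; case: ifPn => [D1_lt|_].
  have [xt xtD] := exists_D1_decoder D1_lt.
  (* With a constant U the information is 0, so every positive rate is achievable. *)
  apply/ler_addgt0Pl => e e0; rewrite addr0; apply: rate_distortion_le.
  apply: (direct_coding PX_dist W_channel d_ge0 trivial_channelP J_gt0 xtD (v := 0)) => //.
  move=> Q Qc; apply: le_trans (aux_info_le trivial_channelP Qc) _.
  by rewrite card_unit ln1 mul0r.
apply: lb_le_inf.
  have [xt xtD] := exists_D0_decoder D_ge.
  eexists; exists Y, identity_channel, xt; split=> //.
  exact: identity_channelP.
move=> _ [U [PU [xt [PUc xtD ->]]]].
apply/ler_addgt0Pl => e e0; rewrite addrC; apply: rate_distortion_le.
apply: (direct_coding PX_dist W_channel d_ge0 PUc J_gt0 xtD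
  (v := sup [set aux_info PX W PU Q | Q in [set Q | is_channel Q]])) => [Q Qc|];
  last by rewrite ltrDl.
apply: ub_le_sup; last by exists Q.
by exists (ln #|U|%:R / ln 2) => _ [Q' Q'c <-]; exact: aux_info_le.
Qed.

Lemma RL_le_rate_distortion D : D0 PX W d <= D ->
  RL PX W d D <= rate_distortion PX W d D.
Proof.
move=> D_ge; have ach0 := exists_achievable D_ge.
rewrite /RL; case: ifPn => [_|_].
  apply: lb_le_inf => // r ach.
  exact: (achievable_ge0 PX_dist W_channel J_gt0 ach).
apply: ge_sup.
  have [Q Qc] := @exists_adversary R X J J_gt0.
  by eexists; exists Q.
move=> _ [Q Qc <-]; apply: lb_le_inf => // r ach.
have [K [Kc KD KI]] := converse PX_dist W_channel d_ge0 J_gt0 ach Qc.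
apply: le_trans KI; apply: ge_inf.
  by exists 0 => _ [U [PU [xt [PUc _ ->]]]]; exact: aux_info_ge0.
by exists {ffun Z -> Xt}, K, (fun (f : {ffun Z -> Xt}) z => f z).
Qed.

End Bounds.

Theorem theorem1 (R : realType) (X Y Z J Xt : finType)
    (J_gt0 : (0 < #|J|)%N) (Xt_gt0 : (0 < #|Xt|)%N)
    (PX : X -> R) (PX_dist : is_dist PX) (PX_gt0 : forall x, 0 < PX x)
    (W : X * J -> Y * Z -> R) (W_channel : is_channel W)
    (d : X -> Xt -> R) (d_ge0 : forall x xt, 0 <= d x xt)
    (D : R) (D_ge : D0 PX W d <= D) :
  RL PX W d D <= rate_distortion PX W d D /\
  rate_distortion PX W d D <= RU PX W d D.
Proof.
by split; [exact: RL_le_rate_distortion|exact: rate_distortion_le_RU].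
Qed.
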